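(* Let $0<\alpha<\tfrac12$, $0<\tau<1$ and $\xi\in\mathbb{R}$, and define $$T_s:=\frac{\sin\pi(1-\tau+\alpha-i\xi)}{\sin\pi(1-\tau+2\alpha-i\xi)},\qquad T_B:=\frac{\sin\pi\alpha}{\pi}\,B(\tau-2\alpha+1+i\xi,2\alpha).$$ (a) If $\xi=0$ and $0<\tau<1$, then $T_s\ne T_B$. (b) If $\xi\ge\tfrac14$ and $\alpha\le\tau<1$, then $|T_s|>|T_B|$. (c) If $0<\xi<\tfrac14$ and $\alpha\le\tau<1$, then $\arg T_s<\arg T_B$. (d) If $\xi>0$ and $0<\tau<\alpha$, then $\arg T_s\ne\arg T_B$. Consequently, the equation $T_s=T_B$ has no solutions with $0<\alpha<\tfrac12$, $0<\tau<1$, $\xi\in\mathbb{R}$.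
   Context: $B(a,b)=\Gamma(a)\Gamma(b)/\Gamma(a+b)$ is the Beta function extended to complex arguments. $\arg$ denotes the principal argument, with values in $(-\pi,\pi]$. *)

(* Defs.v *)
From Stdlib Require Import Reals Lra Arith.
From Coquelicot Require Import Coquelicot.
Open Scope R_scope.
Open Scope C_scope.

Definition cexp (z : C) : C :=
  (exp (Re z) * cos (Im z), exp (Re z) * sin (Im z))%R.

Definition csin (z : C) : C :=
  (cexp (Ci * z) - cexp (- (Ci * z))) / (2 * Ci).

Definition cnpow (n : nat) (z : C) : C := cexp (z * RtoC (ln (INR n))).

Fixpoint poch (z : C) (n : nat) : C :=
  match n with
  | O => z
  | S m => poch z m * (z + RtoC (INR (S m)))
  end.

Definition gauss_term (z : C) (n : nat) : C :=
  RtoC (INR (Factorial.fact n)) * cnpow n z / poch z n.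

(* Complex Gamma via Gauss's limit formula (valid for all z not in {0,-1,-2,...}):
   Gamma z = lim_{n->oo} n! n^z / (z (z+1) ... (z+n)). *)
Definition CGamma (z : C) : C :=
  (real (Lim_seq (fun n => Re (gauss_term z n))),
   real (Lim_seq (fun n => Im (gauss_term z n)))).

Definition CBeta (a b : C) : C := CGamma a * CGamma b / CGamma (a + b).

(* principal argument, values in (-PI, PI] *)
Definition carg (z : C) : R :=
  let x := Re z in let y := Im z in
  if Rlt_dec 0 x then atan (y / x)
  else if Rlt_dec x 0 then
    (if Rle_dec 0 y then atan (y / x) + PI else atan (y / x) - PI)
  else if Rlt_dec 0 y then PI / 2
  else if Rlt_dec y 0 then - (PI / 2)
  else 0.

Definition T_s (alpha tau xi : R) : C :=
  csin (RtoC PI * ((1 - tau + alpha)%R, (- xi)%R))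
  / csin (RtoC PI * ((1 - tau + 2 * alpha)%R, (- xi)%R)).

Definition T_B (alpha tau xi : R) : C :=
  RtoC (sin (PI * alpha) / PI)
  * CBeta ((tau - 2 * alpha + 1)%R, xi) (RtoC (2 * alpha)).

(* Main.v *)
(**
Gauss' product gives [T_B] in polar form: its argument is the sum over [k >= 0] of
[atan (xi / (tau + 1 + k)) - atan (xi / (tau - 2 alpha + 1 + k))].
By the reflection [sin (PI z) = sin (PI (1 - z))], [T_s] is
[sin (PI (tau - alpha + i xi)) / sin (PI (tau - 2 alpha + i xi))]. Minus its argument is
the integral over [tau - 2 alpha, tau - alpha] of the periodic kernel
[PI sinh (2 PI xi) / (cosh (2 PI xi) - cos (2 PI x))], which by a duplication formula
dominates every partial sum of [xi / ((x + k)^2 + xi^2)] over the integers [k].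
Comparing the two sums of arctangents term by term gives [arg T_s < arg T_B] for every
[xi > 0], whence (c) and (d); [xi < 0] follows by conjugation.

For the moduli, the sine product (obtained from the integrals of
[cos t ^ (2m) cos (2xt)]) turns [sin (PI alpha) / PI] into a product that combines with
that of the Beta function. For [alpha <= tau] the result is at most [2 / PI] by
comparison with Wallis' product, while [|T_s| >= tanh (PI xi) > 2 / PI] once
[xi >= 1/4]. For [xi = 0] and [tau < alpha] all factors of [T_s / T_B] are below [1];
for [alpha <= tau <= 2 alpha] one has [T_s <= 0 < T_B]; for [tau > 2 alpha],
[T_B < 1/2 < T_s].
*)

Require Import Defs.
From Stdlib Require Import Reals Lra Lia.
From Coquelicot Require Import Coquelicot.
Open Scope R_scope.

(** * Elementary inequalities for [ln] and [atan] *)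

Lemma nonneg_derive_le (f df : R -> R) (a b : R) :
  a <= b -> (forall x, a <= x <= b -> is_derive f x (df x)) ->
  (forall x, a < x < b -> 0 <= df x) -> f a <= f b.
Proof.
  intros [Hab | ->] Hd Hp; [|lra].
  destruct (MVT_cor2 f df a b Hab) as [c [E Hc]].
  { intros c Hc. apply is_derive_Reals, Hd, Hc. }
  assert (0 <= df c * (b - a)) by (apply Rmult_le_pos; [apply Hp, Hc | lra]).
  lra.
Qed.

Lemma pos_derive_lt (f df : R -> R) (a b : R) :
  a < b -> (forall x, a <= x <= b -> is_derive f x (df x)) ->
  (forall x, a < x < b -> 0 < df x) -> f a < f b.
Proof.
  intros Hab Hd Hp.
  destruct (MVT_cor2 f df a b Hab) as [c [E Hc]].
  { intros c Hc. apply is_derive_Reals, Hd, Hc. }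
  assert (0 < df c * (b - a)) by (apply Rmult_lt_0_compat; [apply Hp, Hc | lra]).
  lra.
Qed.

Lemma ln_one_plus_upper (w : R) : 0 <= w -> ln (1 + w) <= w.
Proof.
  intros Hw. rewrite <- (ln_exp w) at 2.
  apply ln_le; [lra | apply exp_ineq1_le].
Qed.

Lemma ln_one_plus_lower (w : R) : 0 <= w -> w / (1 + w) <= ln (1 + w).
Proof.
  intros Hw.
  assert (H : ln (/ (1 + w)) <= / (1 + w) - 1).
  { rewrite <- (ln_exp (/ (1 + w) - 1)). apply ln_le.
    - apply Rinv_0_lt_compat; lra.
    - generalize (exp_ineq1_le (/ (1 + w) - 1)). lra. }
  rewrite ln_Rinv in H by lra.
  replace (w / (1 + w)) with (1 - / (1 + w)) by (field; lra). lra.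
Qed.

Lemma atan_le_id (u : R) : 0 <= u -> atan u <= u.
Proof.
  intros Hu.
  assert (H : 0 - atan 0 <= u - atan u).
  { apply (nonneg_derive_le (fun v => v - atan v) (fun v => 1 - / (1 + v ^ 2))); auto.
    - intros x _. auto_derive; auto. field. nra.
    - intros x _. assert (/ (1 + x ^ 2) <= / 1) by (apply Rinv_le_contravar; nra). lra. }
  rewrite atan_0 in H. lra.
Qed.

Lemma id_minus_atan_le (u : R) : 0 <= u -> u - atan u <= u ^ 2.
Proof.
  intros Hu.
  assert (H : 0 ^ 2 - 0 + atan 0 <= u ^ 2 - u + atan u).
  { apply (nonneg_derive_le (fun v => v ^ 2 - v + atan v)
             (fun v => 2 * v - v ^ 2 * / (1 + v ^ 2))); auto.
    - intros x _. auto_derive; auto. field. nra.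
    - intros x Hx.
      assert (x ^ 2 * / (1 + x ^ 2) <= 2 * x).
      { apply Rle_div_l; nra. }
      lra. }
  rewrite atan_0 in H. lra.
Qed.

(** With [u = y / (x + N)] this quadratic error is summable over [N], which is enough for the
    convergence of [arg_gauss]. *)
Lemma abs_id_minus_atan (u : R) : Rabs (u - atan u) <= u ^ 2.
Proof.
  destruct (Rle_dec 0 u) as [H | H].
  - rewrite Rabs_pos_eq by (generalize (atan_le_id u H); lra).
    now apply id_minus_atan_le.
  - replace (u - atan u) with (- (- u - atan (- u))) by (rewrite atan_opp; ring).
    rewrite Rabs_Ropp, Rabs_pos_eq by (generalize (atan_le_id (- u)); lra).
    replace (u ^ 2) with ((- u) ^ 2) by ring. apply id_minus_atan_le; lra.
Qed.

(** * Polar form and the complex Gamma function *)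

Definition polar (r t : R) : C := (r * cos t, r * sin t).

Lemma polar_mult (r s a b : R) :
  Cmult (polar r a) (polar s b) = polar (r * s) (a + b).
Proof.
  unfold polar, Cmult; simpl. rewrite cos_plus, sin_plus. f_equal; ring.
Qed.

Lemma polar_inv (r a : R) : 0 < r -> Cinv (polar r a) = polar (/ r) (- a).
Proof.
  intros Hr. unfold polar, Cinv; cbn [fst snd].
  rewrite cos_neg, sin_neg.
  replace ((r * cos a) ^ 2 + (r * sin a) ^ 2) with (r ^ 2).
  - f_equal; field; lra.
  - generalize (sin2_cos2 a). unfold Rsqr. intros H.
    transitivity (r ^ 2 * (sin a * sin a + cos a * cos a)); [rewrite H |]; ring.
Qed.

Lemma polar_div (r s a b : R) :
  0 < s -> Cdiv (polar r a) (polar s b) = polar (r / s) (a - b).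
Proof.
  intros Hs. unfold Cdiv. now rewrite polar_inv, polar_mult.
Qed.

Lemma polar_real (r : R) : RtoC r = polar r 0.
Proof. unfold polar, RtoC. rewrite cos_0, sin_0. f_equal; ring. Qed.

Lemma Cmod_polar (r t : R) : 0 <= r -> Cmod (polar r t) = r.
Proof.
  intros Hr. unfold Cmod, polar; cbn [fst snd].
  replace ((r * cos t) ^ 2 + (r * sin t) ^ 2) with (r ^ 2).
  - now apply sqrt_pow2.
  - generalize (sin2_cos2 t). unfold Rsqr. intros H.
    transitivity (r ^ 2 * (sin t * sin t + cos t * cos t)); [rewrite H |]; ring.
Qed.

Lemma carg_polar (r t : R) : 0 < r -> - PI < t < 0 -> carg (polar r t) = t.
Proof.
  intros Hr Ht.
  assert (HPI := PI_RGT_0).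
  assert (Hs : r * sin t < 0).
  { assert (sin t < 0) by (apply sin_lt_0_var; lra). nra. }
  unfold carg, polar; cbn [Re Im fst snd].
  assert (Et : cos t <> 0 -> r * sin t / (r * cos t) = tan t).
  { intros Hc. unfold tan. field. lra. }
  destruct (Rtotal_order (- (PI / 2)) t) as [H | [H | H]].
  - assert (0 < cos t) by (apply cos_gt_0; lra).
    destruct (Rlt_dec 0 (r * cos t)) as [_ | N]; [|nra].
    rewrite Et by lra. apply atan_tan. lra.
  - assert (E : cos t = 0) by (rewrite <- H, cos_neg; apply cos_PI2).
    rewrite E, Rmult_0_r.
    repeat (destruct Rlt_dec; try lra).
  - assert (cos t < 0) by (rewrite <- cos_neg; apply cos_lt_0; lra).
    destruct (Rlt_dec 0 (r * cos t)); [nra|].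
    destruct (Rlt_dec (r * cos t) 0); [|nra].
    destruct (Rle_dec 0 (r * sin t)); [lra|].
    rewrite Et by lra.
    (* [t + PI] lies in [(0, PI / 2)], where [atan] inverts [tan]; this branch of [carg] subtracts
       the [PI] again. *)
    replace (tan t) with (tan (t + PI)).
    + rewrite atan_tan by lra. ring.
    + unfold tan. rewrite neg_sin, neg_cos. field. lra.
Qed.

(** The modulus is written as the exponential of half a logarithm so that products of moduli become
    sums of logarithms. *)
Lemma polar_of_right_half_plane (x y : R) :
  0 < x -> (x, y) = polar (exp (/ 2 * ln (x ^ 2 + y ^ 2))) (atan (y / x)).
Proof.
  intros Hx.
  assert (Hp : 0 < x ^ 2 + y ^ 2) by nra.
  assert (E : exp (/ 2 * ln (x ^ 2 + y ^ 2)) = x * sqrt (1 + (y / x)²)).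
  { change (exp (/ 2 * ln (x ^ 2 + y ^ 2))) with (Rpower (x ^ 2 + y ^ 2) (/ 2)).
    rewrite Rpower_sqrt by assumption.
    rewrite <- (sqrt_pow2 x) at 2 by lra.
    rewrite <- sqrt_mult_alt by nra.
    f_equal. unfold Rsqr. field. lra. }
  assert (0 < sqrt (1 + (y / x)²)).
  { apply sqrt_lt_R0. generalize (Rle_0_sqr (y / x)). lra. }
  unfold polar. rewrite E, cos_atan, sin_atan. f_equal; field; lra.
Qed.

Lemma poch_polar (x y : R) (n : nat) :
  0 < x ->
  poch (x, y) n =
  polar (exp (sum_f_R0 (fun k => / 2 * ln ((x + INR k) ^ 2 + y ^ 2)) n))
        (sum_f_R0 (fun k => atan (y / (x + INR k))) n).
Proof.
  intros Hx. induction n as [|n IH].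
  - simpl sum_f_R0. rewrite Rplus_0_r. now apply polar_of_right_half_plane.
  - change (poch (x, y) (S n))
      with (Cmult (poch (x, y) n) (Cplus (x, y) (RtoC (INR (S n))))).
    rewrite IH, !tech5, exp_plus.
    replace (Cplus (x, y) (RtoC (INR (S n)))) with ((x + INR (S n), y) : C).
    + rewrite (polar_of_right_half_plane (x + INR (S n)) y).
      * apply polar_mult.
      * generalize (pos_INR (S n)). lra.
    + unfold Cplus, RtoC; simpl. f_equal; ring.
Qed.

Definition lnfact (n : nat) : R := ln (INR (Factorial.fact n)).

Lemma lnfact_0 : lnfact 0 = 0.
Proof. apply ln_1. Qed.

Lemma lnfact_1 : lnfact 1 = 0.
Proof. apply ln_1. Qed.

Lemma lnfact_S (n : nat) : lnfact (S n) = lnfact n + ln (INR (S n)).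
Proof.
  unfold lnfact. rewrite fact_simpl, mult_INR.
  rewrite Rmult_comm, ln_mult; [ring | apply INR_fact_lt_0 | apply lt_0_INR; lia].
Qed.

Definition log_mod_gauss (x y : R) (n : nat) : R :=
  lnfact n + x * ln (INR n)
  - sum_f_R0 (fun k => / 2 * ln ((x + INR k) ^ 2 + y ^ 2)) n.

Definition arg_gauss (x y : R) (n : nat) : R :=
  y * ln (INR n) - sum_f_R0 (fun k => atan (y / (x + INR k))) n.

Lemma gauss_term_polar (x y : R) (n : nat) :
  0 < x ->
  gauss_term (x, y) n = polar (exp (log_mod_gauss x y n)) (arg_gauss x y n).
Proof.
  intros Hx. unfold gauss_term. rewrite poch_polar, polar_real by assumption.
  replace (cnpow n (x, y)) with (polar (exp (x * ln (INR n))) (y * ln (INR n))).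
  - rewrite polar_mult, polar_div by apply exp_pos.
    unfold log_mod_gauss, arg_gauss. f_equal.
    + unfold Rminus. rewrite !exp_plus, exp_Ropp. unfold lnfact.
      rewrite exp_ln by apply INR_fact_lt_0. reflexivity.
    + ring.
  - unfold cnpow, cexp, polar, RtoC, Cmult; simpl.
    repeat (f_equal; try ring).
Qed.

(** * Convergence of Gauss' product in logarithmic form *)

Lemma is_lim_seq_inv_succ : is_lim_seq (fun n => / INR (S n)) 0.
Proof.
  apply (is_lim_seq_incr_1 (fun n => / INR n)).
  apply (is_lim_seq_inv INR p_infty); [apply is_lim_seq_INR | discriminate].
Qed.

(** The bound telescopes: [u n - c / n] is nondecreasing and [u n + c / n] nonincreasing, so the
    former is bounded by [u 1 + c] and converges, and [c / n] tends to [0]. *)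
Lemma ex_lim_summable_increments (u : nat -> R) (c : R) :
  (forall n, (1 <= n)%nat ->
     Rabs (u (S n) - u n) <= c * (/ INR n - / INR (S n))) ->
  ex_finite_lim_seq u.
Proof.
  intros H.
  assert (Hlo : ex_finite_lim_seq (fun n => u (S n) - c * / INR (S n))).
  { apply ex_finite_lim_seq_incr with (M := u 1%nat + c * / INR 1 - 0).
    - intros n. generalize (H (S n) ltac:(lia)).
      intros E. apply Rabs_le_between in E. lra.
    - intros n. change (/ INR 1) with (/ 1).
      assert (u (S n) + c * / INR (S n) <= u 1%nat + c * / 1).
      { induction n as [|n IH]; [simpl; lra|].
        generalize (H (S n) ltac:(lia)).
        intros E. apply Rabs_le_between in E. lra. }
      assert (0 <= c).
      { generalize (Rabs_pos (u 2%nat - u 1%nat)) (H 1%nat (Nat.le_refl 1)).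
        simpl. lra. }
      assert (0 <= c * / INR (S n)).
      { apply Rmult_le_pos; [assumption|].
        left. apply Rinv_0_lt_compat, lt_0_INR. lia. }
      lra. }
  destruct Hlo as [l Hl].
  exists l. apply is_lim_seq_incr_1.
  apply is_lim_seq_ext with (fun n => (u (S n) - c * / INR (S n)) + c * / INR (S n)).
  { intros n. ring. }
  replace (Finite l) with (Finite (l + c * 0)) by (f_equal; ring).
  apply is_lim_seq_plus'; [exact Hl|].
  apply (is_lim_seq_scal_l _ c 0).
  exact is_lim_seq_inv_succ.
Qed.

Lemma ln_succ_bounds (n : nat) :
  (1 <= n)%nat -> / INR (S n) <= ln (INR (S n)) - ln (INR n) <= / INR n.
Proof.
  intros Hn. assert (Hp : 0 < INR n) by (apply lt_0_INR; lia).
  assert (Hi := Rinv_0_lt_compat _ Hp).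
  rewrite <- ln_div by (rewrite ?S_INR; lra).
  replace (INR (S n) / INR n) with (1 + / INR n) by (rewrite S_INR; field; lra).
  split.
  - replace (/ INR (S n)) with (/ INR n / (1 + / INR n)).
    + apply ln_one_plus_lower; lra.
    + rewrite S_INR. field. lra.
  - apply ln_one_plus_upper; lra.
Qed.

Lemma inv_sqr_le_telescope (n : nat) :
  (1 <= n)%nat -> (/ INR (S n)) ^ 2 <= / INR n - / INR (S n).
Proof.
  intros Hn. assert (Hp : 1 <= INR n) by (apply (le_INR 1); lia).
  rewrite S_INR. set (m := INR n) in *.
  replace (/ m - / (m + 1)) with (/ (m * (m + 1))) by (field; lra).
  rewrite pow_inv. apply Rinv_le_contravar; nra.
Qed.

(** With [N = n + 1] and [u = y / (x + N)] the increment is [y (ln N - ln n - 1/N) + y (1/N - 1/(x +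
    N)) + (u - atan u)]. The three parts are bounded by the three summands of [c], each times
    [1/n - 1/N]. *)
Lemma ex_lim_arg_gauss (x y : R) : 0 < x -> ex_finite_lim_seq (arg_gauss x y).
Proof.
  intros Hx.
  apply ex_lim_summable_increments with (c := Rabs y + Rabs y * x + y ^ 2).
  intros n Hn. unfold arg_gauss. rewrite tech5.
  destruct (ln_succ_bounds n Hn) as [L1 L2].
  assert (T := inv_sqr_le_telescope n Hn).
  assert (HN : 0 < INR (S n)) by (apply lt_0_INR; lia).
  set (N := INR (S n)) in *. set (l := ln N - ln (INR n)) in *.
  set (d := / INR n - / N) in *.
  assert (Hi := Rinv_0_lt_compat _ HN).
  assert (E : forall s, y * ln N - (s + atan (y / (x + N))) - (y * ln (INR n) - s)
    = y * (l - / N) + y * (/ N - / (x + N)) + (y / (x + N) - atan (y / (x + N)))).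
  { intros s. unfold l, Rdiv. ring. }
  rewrite E.
  assert (A1 : Rabs (y * (l - / N)) <= Rabs y * d).
  { rewrite Rabs_mult. apply Rmult_le_compat_l; [apply Rabs_pos|].
    apply Rabs_le_between. unfold d. lra. }
  assert (Hxi : 0 < / (x + N) <= / N).
  { split; [apply Rinv_0_lt_compat; lra | apply Rinv_le_contravar; lra]. }
  assert (A2 : Rabs (y * (/ N - / (x + N))) <= Rabs y * x * d).
  { rewrite Rabs_mult, Rmult_assoc. apply Rmult_le_compat_l; [apply Rabs_pos|].
    replace (/ N - / (x + N)) with (x * (/ N * / (x + N))) by (field; lra).
    assert (0 <= / N * / (x + N) <= (/ N) ^ 2) by nra.
    rewrite Rabs_pos_eq by nra. apply Rmult_le_compat_l; lra. }
  assert (A3 : Rabs (y / (x + N) - atan (y / (x + N))) <= y ^ 2 * d).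
  { eapply Rle_trans; [apply abs_id_minus_atan|].
    unfold Rdiv. rewrite Rpow_mult_distr.
    apply Rmult_le_compat_l; [nra|].
    eapply Rle_trans; [|exact T]. nra. }
  eapply Rle_trans; [apply Rabs_triang|].
  eapply Rle_trans; [apply Rplus_le_compat_r, Rabs_triang|].
  lra.
Qed.

(** Since [(x + N)^2 + y^2 = N^2 (1 + w)] with [w = 2x/N + q/N^2], the increment is
    [x (ln N - ln n - 1/N)] plus [x/N - ln (1 + w) / 2]. The latter is of order [1/N^2], because
    [w - w^2 <= ln (1 + w) <= w]. *)
Lemma ex_lim_log_mod_gauss (x y : R) :
  0 < x -> ex_finite_lim_seq (log_mod_gauss x y).
Proof.
  intros Hx.
  set (q := x ^ 2 + y ^ 2).
  assert (Hq : 0 <= q) by (unfold q; nra).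
  apply ex_lim_summable_increments with (c := x + (/ 2 * q + / 2 * (2 * x + q) ^ 2)).
  intros n Hn. unfold log_mod_gauss. rewrite tech5, lnfact_S.
  destruct (ln_succ_bounds n Hn) as [L1 L2].
  assert (T := inv_sqr_le_telescope n Hn).
  assert (HN : 1 <= INR (S n)) by (apply (le_INR 1); lia).
  set (N := INR (S n)) in *. set (l := ln N - ln (INR n)) in *.
  set (d := / INR n - / N) in *.
  assert (Hi : 0 < / N <= 1).
  { split; [apply Rinv_0_lt_compat; lra|].
    rewrite <- Rinv_1. apply Rinv_le_contravar; lra. }
  set (w := 2 * x * / N + q * (/ N) ^ 2).
  assert (Hqi : 0 <= q * (/ N) ^ 2 <= q * / N).
  { assert (0 <= (/ N) ^ 2 <= / N) by nra. split; [nra|].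
    apply Rmult_le_compat_l; lra. }
  assert (Hw : 0 <= w <= (2 * x + q) * / N).
  { assert (0 <= x * / N) by nra. unfold w. lra. }
  assert (Ew : / 2 * ln ((x + N) ^ 2 + y ^ 2) = ln N + / 2 * ln (1 + w)).
  { replace ((x + N) ^ 2 + y ^ 2) with (N * N * (1 + w)).
    - rewrite (ln_mult (N * N)), ln_mult by nra. field.
    - unfold w, q. field. lra. }
  rewrite Ew.
  assert (E : forall s, lnfact n + ln N + x * ln N - (s + (ln N + / 2 * ln (1 + w)))
      - (lnfact n + x * ln (INR n) - s)
    = x * (l - / N) + (x * / N - / 2 * ln (1 + w))).
  { intros s. unfold l. ring. }
  rewrite E.
  assert (A1 : Rabs (x * (l - / N)) <= x * d).
  { rewrite Rabs_mult, (Rabs_pos_eq x) by lra. apply Rmult_le_compat_l; [lra|].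
    apply Rabs_le_between. unfold d. lra. }
  assert (A2 : Rabs (x * / N - / 2 * ln (1 + w))
               <= (/ 2 * q + / 2 * (2 * x + q) ^ 2) * (/ N) ^ 2).
  { assert (U1 := ln_one_plus_upper w (proj1 Hw)).
    assert (U2 := ln_one_plus_lower w (proj1 Hw)).
    assert (U3 : w - w ^ 2 <= w / (1 + w)).
    { apply Rle_div_r; [lra|]. nra. }
    assert (U4 : w ^ 2 <= (2 * x + q) ^ 2 * (/ N) ^ 2) by nra.
    assert (0 <= (2 * x + q) ^ 2 * (/ N) ^ 2) by nra.
    replace (x * / N) with (/ 2 * (w - q * (/ N) ^ 2)) by (unfold w; field; lra).
    apply Rabs_le_between. lra. }
  eapply Rle_trans; [apply Rabs_triang|].
  assert (0 <= / 2 * q + / 2 * (2 * x + q) ^ 2) by nra.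
  assert ((/ 2 * q + / 2 * (2 * x + q) ^ 2) * (/ N) ^ 2
          <= (/ 2 * q + / 2 * (2 * x + q) ^ 2) * d) by (apply Rmult_le_compat_l; lra).
  lra.
Qed.

(** [CGamma] takes the limits of real and imaginary parts separately; both follow from the limits of
    log-modulus and argument by continuity of [exp], [cos] and [sin]. *)
Lemma CGamma_polar (x y : R) :
  0 < x ->
  exists l t : R,
    is_lim_seq (log_mod_gauss x y) l /\ is_lim_seq (arg_gauss x y) t /\
    CGamma (x, y) = polar (exp l) t.
Proof.
  intros Hx.
  destruct (ex_lim_log_mod_gauss x y Hx) as [l Hl].
  destruct (ex_lim_arg_gauss x y Hx) as [t Ht].
  exists l, t. repeat split; auto.
  assert (He : is_lim_seq (fun n => exp (log_mod_gauss x y n)) (exp l)).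
  { apply is_lim_seq_continuous; auto. apply derivable_continuous_pt, derivable_pt_exp. }
  assert (Hc : is_lim_seq (fun n => cos (arg_gauss x y n)) (cos t)).
  { apply is_lim_seq_continuous; auto. apply continuity_cos. }
  assert (Hs : is_lim_seq (fun n => sin (arg_gauss x y n)) (sin t)).
  { apply is_lim_seq_continuous; auto. apply continuity_sin. }
  unfold CGamma, polar. f_equal.
  - rewrite (Lim_seq_ext _ (fun n => exp (log_mod_gauss x y n) * cos (arg_gauss x y n))).
    + erewrite is_lim_seq_unique; [|apply is_lim_seq_mult'; eassumption]. reflexivity.
    + intros n. now rewrite gauss_term_polar.
  - rewrite (Lim_seq_ext _ (fun n => exp (log_mod_gauss x y n) * sin (arg_gauss x y n))).
    + erewrite is_lim_seq_unique; [|apply is_lim_seq_mult'; eassumption]. reflexivity.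
    + intros n. now rewrite gauss_term_polar.
Qed.

(** * The sine product *)

(** Wallis' integral of an even power of the cosine, twisted by the frequency [2 x]; the quotient by
    its value at [x = 0] generates the sine product. *)
Definition wallis_int (m : nat) (x : R) : R :=
  RInt (fun t => cos t ^ (2 * m) * cos (2 * x * t)) 0 (PI / 2).

Lemma ex_wallis_int (m : nat) (x : R) :
  ex_RInt (fun t => cos t ^ (2 * m) * cos (2 * x * t)) 0 (PI / 2).
Proof.
  apply (ex_RInt_continuous (V := R_CompleteNormedModule)). intros t _.
  apply (ex_derive_continuous (K := R_AbsRing) (V := R_NormedModule)).
  auto_derive; auto.
Qed.

(* Green's identity for [cos t ^ (2m+2)] and [cos (2xt)]. *)
Lemma wallis_int_rec (m : nat) (x : R) :
  ((2 * INR m + 2) ^ 2 - 4 * x ^ 2) * wallis_int (S m) x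
  = (2 * INR m + 2) * (2 * INR m + 1) * wallis_int m x.
Proof.
  set (c := 2 * INR m + 2).
  (* [F] is the Wronskian [u' v - u v'] of [u = cos t ^ (2m+2)] and [v = cos (2xt)]. It vanishes at
     [PI / 2] through the powers of the cosine and at [0] through the sines. *)
  set (F := fun t => - c * cos t ^ S (2 * m) * sin t * cos (2 * x * t)
                     + 2 * x * cos t ^ S (S (2 * m)) * sin (2 * x * t)).
  set (f := fun t => c * (c - 1) * (cos t ^ (2 * m) * cos (2 * x * t))
             - (c ^ 2 - 4 * x ^ 2) * (cos t ^ (2 * S m) * cos (2 * x * t))).
  assert (HF : is_RInt f 0 (PI / 2) (minus (F (PI / 2)) (F 0))).
  { apply (is_RInt_derive (V := R_CompleteNormedModule)).
    - intros t _. unfold F, f.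
      replace (2 * S m)%nat with (S (S (2 * m))) by lia.
      assert (EN : INR (2 * m) = c - 2) by (rewrite mult_INR; unfold c; simpl; ring).
      generalize (2 * m)%nat EN. clear -c. intros N EN.
      auto_derive; auto.
      change (match N with 0%nat => 1 | S _ => INR N + 1 end) with (INR (S N)).
      rewrite S_INR, EN. simpl (cos t ^ S (S N)).
      transitivity (c * (c - 1) * (cos t ^ N * cos (2 * x * t)) * (sin t * sin t)
        + (4 * x ^ 2 - c) * (cos t * (cos t * cos t ^ N) * cos (2 * x * t))); [ring|].
      replace (sin t * sin t) with (1 - cos t * cos t); [ring|].
      generalize (sin2_cos2 t). unfold Rsqr. lra.
    - intros t _. apply (ex_derive_continuous (K := R_AbsRing) (V := R_NormedModule)).
      unfold f. auto_derive; auto. }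
  replace (minus (F (PI / 2)) (F 0)) with 0 in HF.
  2:{ unfold F, minus, plus, opp; simpl.
      rewrite cos_PI2, !Rmult_0_r, sin_0. ring. }
  assert (HG : is_RInt f 0 (PI / 2) (c * (c - 1) * wallis_int m x
                 - (c ^ 2 - 4 * x ^ 2) * wallis_int (S m) x)).
  { apply (is_RInt_minus (V := R_NormedModule));
      apply (is_RInt_scal (V := R_NormedModule));
      apply (RInt_correct (V := R_CompleteNormedModule)), ex_wallis_int. }
  assert (E : c * (c - 1) * wallis_int m x
              - (c ^ 2 - 4 * x ^ 2) * wallis_int (S m) x = 0).
  { rewrite <- (is_RInt_unique _ _ _ _ HG). now apply is_RInt_unique. }
  replace (2 * INR m + 1) with (c - 1) by (unfold c; ring). lra.
Qed.

Lemma wallis_int_0 (x : R) : x <> 0 -> wallis_int 0 x = sin (PI * x) / (2 * x).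
Proof.
  intros Hx. unfold wallis_int.
  apply is_RInt_unique.
  replace (sin (PI * x) / (2 * x))
    with (minus (sin (2 * x * (PI / 2)) / (2 * x)) (sin (2 * x * 0) / (2 * x))).
  - apply (is_RInt_derive (V := R_CompleteNormedModule) (fun t => sin (2 * x * t) / (2 * x))).
    + intros t _. auto_derive; auto. simpl. field. assumption.
    + intros t _. apply (ex_derive_continuous (K := R_AbsRing) (V := R_NormedModule)).
      auto_derive; auto.
  - unfold minus, plus, opp; simpl. rewrite Rmult_0_r, sin_0.
    replace (2 * x * (PI / 2)) with (PI * x) by field. field. assumption.
Qed.

Lemma wallis_int_00 : wallis_int 0 0 = PI / 2.
Proof.
  unfold wallis_int. rewrite (RInt_ext _ (fun _ => 1)).
  - rewrite RInt_const. unfold scal; simpl. unfold mult; simpl. lra.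
  - intros t _. simpl. rewrite Rmult_0_r, Rmult_0_l, cos_0. ring.
Qed.

Lemma wallis_int_pos (m : nat) : 0 < wallis_int m 0.
Proof.
  induction m as [|m IH].
  - rewrite wallis_int_00. generalize PI_RGT_0. lra.
  - generalize (wallis_int_rec m 0) (pos_INR m). intros E Hm.
    replace (wallis_int (S m) 0)
      with ((2 * INR m + 1) / (2 * INR m + 2) * wallis_int m 0).
    + apply Rmult_lt_0_compat; [apply Rdiv_lt_0_compat|]; lra.
    + apply Rmult_eq_reg_l with ((2 * INR m + 2) ^ 2); [|nra].
      transitivity ((2 * INR m + 2) * (2 * INR m + 1) * wallis_int m 0); [field; lra|].
      rewrite <- E. ring.
Qed.

Lemma sin_sqr_le (u : R) : sin u ^ 2 <= u ^ 2.
Proof.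
  assert (P : forall v, 0 <= v -> sin v ^ 2 <= v ^ 2).
  { intros v Hv.
    assert (sin v <= v) by (destruct (Req_dec v 0) as [-> | N];
      [rewrite sin_0; lra | left; apply sin_lt_x; lra]).
    assert (- v <= sin v).
    { generalize (SIN_bound v) PI2_1. intros [H1 H2] H3.
      destruct (Rle_dec v 1); [|lra].
      assert (0 <= sin v) by (apply sin_ge_0; lra). lra. }
    nra. }
  destruct (Rle_dec 0 u) as [H | H]; [now apply P|].
  generalize (P (- u) ltac:(lra)). rewrite sin_neg. nra.
Qed.

Lemma one_minus_cos_le (u : R) : 0 <= 1 - cos u <= u ^ 2 / 2.
Proof.
  split; [generalize (COS_bound u); lra|].
  assert (E : 1 - cos u = 2 * sin (u / 2) ^ 2).
  { replace u with (2 * (u / 2)) at 1 by field. rewrite cos_2a_sin. ring. }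
  generalize (sin_sqr_le (u / 2)). nra.
Qed.

Lemma id_mul_cos_le_sin (t : R) : 0 <= t <= PI / 2 -> 0 <= t * cos t <= sin t.
Proof.
  intros Ht. split.
  { apply Rmult_le_pos; [lra | apply cos_ge_0; lra]. }
  assert (H : sin 0 - 0 * cos 0 <= sin t - t * cos t).
  { apply (nonneg_derive_le (fun s => sin s - s * cos s) (fun s => s * sin s)); [lra| |].
    - intros s _. auto_derive; auto. ring.
    - intros s Hs. apply Rmult_le_pos; [lra | apply sin_ge_0; lra]. }
  rewrite sin_0 in H. lra.
Qed.

(* [t cos t <= sin t] turns [t^2 cos^(2m+2) t] into [cos^(2m) t - cos^(2m+2) t]. *)
Lemma wallis_int_near (m : nat) (x : R) :
  0 <= wallis_int (S m) 0 - wallis_int (S m) x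
    <= 2 * x ^ 2 / (2 * INR m + 1) * wallis_int (S m) 0.
Proof.
  assert (HPI := PI_RGT_0).
  assert (Hm := pos_INR m).
  assert (B : forall t, 0 < t < PI / 2 ->
    0 <= cos t ^ (2 * S m) * cos (2 * 0 * t) - cos t ^ (2 * S m) * cos (2 * x * t)
      <= 2 * x ^ 2 * (cos t ^ (2 * m) * cos (2 * 0 * t) - cos t ^ (2 * S m) * cos (2 * 0 * t))).
  { intros t Ht.
    replace (2 * 0 * t) with 0 by ring. rewrite cos_0.
    replace (2 * S m)%nat with (2 * m + 2)%nat by lia. rewrite pow_add.
    assert (P : 0 <= cos t ^ (2 * m)) by (apply pow_le, cos_ge_0; lra).
    generalize (cos t ^ (2 * m)) P. intros p Hp.
    assert (H1 := one_minus_cos_le (2 * x * t)).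
    assert (H2 := id_mul_cos_le_sin t ltac:(lra)).
    assert (H3 : 1 - cos t ^ 2 = sin t ^ 2) by (generalize (sin2_cos2 t); unfold Rsqr; lra).
    split.
    - replace (p * cos t ^ 2 * 1 - p * cos t ^ 2 * cos (2 * x * t))
        with (p * cos t ^ 2 * (1 - cos (2 * x * t))) by ring.
      apply Rmult_le_pos; [|lra]. apply Rmult_le_pos; [lra|nra].
    - replace (p * cos t ^ 2 * 1 - p * cos t ^ 2 * cos (2 * x * t))
        with (p * (cos t ^ 2 * (1 - cos (2 * x * t)))) by ring.
      replace (2 * x ^ 2 * (p * 1 - p * cos t ^ 2 * 1))
        with (p * (2 * x ^ 2 * (1 - cos t ^ 2))) by ring.
      apply Rmult_le_compat_l; [assumption|]. rewrite H3.
      assert (S1 : (t * cos t) ^ 2 <= sin t ^ 2) by nra.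
      assert (S2 : cos t ^ 2 * (1 - cos (2 * x * t)) <= cos t ^ 2 * ((2 * x * t) ^ 2 / 2)).
      { apply Rmult_le_compat_l; [nra | lra]. }
      assert (S3 : 2 * x ^ 2 * (t * cos t) ^ 2 <= 2 * x ^ 2 * sin t ^ 2).
      { apply Rmult_le_compat_l; [nra | lra]. }
      nra. }
  assert (R1 : wallis_int (S m) x <= wallis_int (S m) 0).
  { apply RInt_le; try apply ex_wallis_int; [lra|]. intros t Ht. generalize (B t Ht). lra. }
  assert (R2 : wallis_int (S m) 0 - wallis_int (S m) x
               <= 2 * x ^ 2 * (wallis_int m 0 - wallis_int (S m) 0)).
  { unfold wallis_int.
    rewrite <- (RInt_minus (V := R_CompleteNormedModule)) by apply ex_wallis_int.
    rewrite <- (RInt_minus (V := R_CompleteNormedModule)) by apply ex_wallis_int.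
    rewrite <- (RInt_scal (V := R_CompleteNormedModule)).
    2:{ apply (ex_RInt_minus (V := R_NormedModule)); apply ex_wallis_int. }
    apply RInt_le; [lra| | |].
    - apply (ex_RInt_minus (V := R_NormedModule)); apply ex_wallis_int.
    - apply (ex_RInt_scal (V := R_NormedModule)), (ex_RInt_minus (V := R_NormedModule));
        apply ex_wallis_int.
    - intros t Ht. apply (B t Ht). }
  split; [lra|]. eapply Rle_trans; [exact R2|]. right.
  (* The recursion at [x = 0] gives [wallis_int m 0 - wallis_int (S m) 0 = wallis_int (S m) 0 / (2m
     + 1)]. *)
  assert (E := wallis_int_rec m 0).
  replace (wallis_int m 0) with ((2 * INR m + 2) / (2 * INR m + 1) * wallis_int (S m) 0).
  - field. lra.
  - apply Rmult_eq_reg_l with ((2 * INR m + 2) * (2 * INR m + 1)); [|nra].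
    rewrite <- E. field. lra.
Qed.

(** Euler's partial products for [sin (PI * x)]. *)
Fixpoint sine_prod (x : R) (m : nat) : R :=
  match m with
  | O => PI * x
  | S k => sine_prod x k * (1 - x ^ 2 / (INR (S k)) ^ 2)
  end.

(** Dividing the recursion at [x] by the one at [0] produces exactly the factor [1 - x^2 / (m+1)^2];
    for [m = 0] both integrals are explicit. *)
Lemma sine_prod_wallis (x : R) (m : nat) :
  0 < x < 1 ->
  sin (PI * x) * wallis_int m 0 = sine_prod x m * wallis_int m x.
Proof.
  intros Hx. induction m as [|m IH].
  - rewrite wallis_int_00, wallis_int_0 by lra. simpl. field. lra.
  - assert (Hm := pos_INR m).
    assert (E0 := wallis_int_rec m 0). assert (Ex := wallis_int_rec m x).
    set (c := 2 * INR m + 2) in *.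
    change (sine_prod x (S m)) with (sine_prod x m * (1 - x ^ 2 / (INR (S m)) ^ 2)).
    assert (Hc : INR (S m) = c / 2) by (rewrite S_INR; unfold c; field).
    rewrite Hc.
    assert (c <> 0) by (unfold c; lra).
    apply Rmult_eq_reg_l with (c ^ 2); [|nra].
    transitivity (sin (PI * x) * ((c ^ 2 - 4 * 0 ^ 2) * wallis_int (S m) 0)); [ring|].
    transitivity (sine_prod x m * ((c ^ 2 - 4 * x ^ 2) * wallis_int (S m) x)); [|field; lra].
    rewrite E0, Ex.
    transitivity (c * (2 * INR m + 1) * (sin (PI * x) * wallis_int m 0)); [ring|].
    rewrite IH. ring.
Qed.

Lemma is_lim_seq_const_div_odd (c : R) :
  is_lim_seq (fun m => c / (2 * INR m + 1)) 0.
Proof.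
  replace (Finite 0) with (Rbar_mult c 0) by (simpl; f_equal; ring).
  apply is_lim_seq_scal_l.
  apply (is_lim_seq_inv _ p_infty); [|discriminate].
  apply is_lim_seq_le_p_loc with INR; [|apply is_lim_seq_INR].
  exists 0%nat. intros n _. generalize (pos_INR n). lra.
Qed.

Lemma sine_prod_lim (x : R) :
  0 < x < 1 -> is_lim_seq (sine_prod x) (sin (PI * x)).
Proof.
  intros Hx. apply is_lim_seq_incr_1.
  (* The partial product is [sin (PI * x) / r m], and [wallis_int_near] squeezes [r m] between
     [1 - 2 x^2 / (2m + 1)] and [1]. *)
  set (r := fun m => wallis_int (S m) x / wallis_int (S m) 0).
  assert (Hr : is_lim_seq r 1).
  { apply is_lim_seq_le_le with (fun m => 1 - 2 * x ^ 2 / (2 * INR m + 1)) (fun _ => 1).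
    - intros m. assert (P := wallis_int_pos (S m)).
      assert (N := wallis_int_near m x). unfold r. split.
      + apply Rle_div_r; lra.
      + apply Rle_div_l; lra.
    - replace (Finite 1) with (Finite (1 - 0)) by (f_equal; ring).
      apply is_lim_seq_minus'; [apply is_lim_seq_const | apply is_lim_seq_const_div_odd].
    - apply is_lim_seq_const. }
  assert (S0 : sin (PI * x) <> 0).
  { apply Rgt_not_eq, sin_gt_0; generalize PI_RGT_0; nra. }
  apply is_lim_seq_ext with (fun m => sin (PI * x) / r m).
  - intros m. assert (E := sine_prod_wallis x (S m) Hx).
    assert (P := wallis_int_pos (S m)).
    assert (wallis_int (S m) x <> 0) by (intros Z; rewrite Z in E; nra).
    unfold r. apply Rmult_eq_reg_r with (wallis_int (S m) x); [|assumption].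
    rewrite <- E. field. split; lra.
  - replace (Finite (sin (PI * x))) with (Finite (sin (PI * x) / 1)) by (f_equal; field).
    apply is_lim_seq_div'; [apply is_lim_seq_const | assumption | lra].
Qed.

(** The numerators [N - x] with [N <= n + 1] are the [1 - x + k] with [k <= n], but the factors
    [x, x + 1, ..., x + n + 1] exceed the [x + k] by one. That last factor over [n + 1] is the
    correction [1 + x / (n + 1)]. *)
Lemma sine_prod_log (x : R) (n : nat) :
  0 < x < 1 ->
  0 < sine_prod x (S n) /\
  ln (sine_prod x (S n)) =
  ln PI + (sum_f_R0 (fun k => ln (x + INR k) + ln (1 - x + INR k)) n
  - lnfact n - lnfact (S n)) + ln (1 + x / INR (S n)).
Proof.
  intros Hx.
  assert (HPI := PI_RGT_0).
  assert (F : forall N, 1 <= N -> 1 - x ^ 2 / N ^ 2 = (1 + x / N) * ((N - x) / N)).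
  { intros N HN. field. lra. }
  assert (Q : forall N, 1 <= N -> 0 < x / N).
  { intros N HN. apply Rdiv_lt_0_compat; lra. }
  induction n as [|n [IP IH]].
  - simpl sine_prod. simpl sum_f_R0. unfold lnfact; simpl.
    replace (1 - x * (x * 1) / (1 * (1 * 1))) with ((1 - x) * (1 + x)) by field.
    replace (x / 1) with x by field. rewrite !Rplus_0_r, ln_1.
    assert (0 < PI * x) by nra. assert (0 < (1 - x) * (1 + x)) by nra.
    split; [nra|].
    rewrite !ln_mult by lra. ring.
  - change (sine_prod x (S (S n)))
      with (sine_prod x (S n) * (1 - x ^ 2 / (INR (S (S n))) ^ 2)).
    rewrite tech5, !(lnfact_S (S n)), (lnfact_S n).
    assert (H1 : 1 <= INR (S n)) by (apply (le_INR 1); lia).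
    assert (H2 : INR (S (S n)) = INR (S n) + 1) by apply S_INR.
    rewrite (lnfact_S n) in IH.
    set (N := INR (S n)) in *. set (N' := INR (S (S n))) in *.
    assert (Q1 := Q N H1). assert (Q2 := Q N' ltac:(lra)).
    assert (0 < (N' - x) / N') by (apply Rdiv_lt_0_compat; lra).
    rewrite F by lra.
    assert (0 < (1 + x / N') * ((N' - x) / N')) by (apply Rmult_lt_0_compat; lra).
    split; [now apply Rmult_lt_0_compat|].
    rewrite ln_mult, ln_mult, IH by lra.
    rewrite ln_div by lra.
    replace (ln (1 + x / N)) with (ln (x + N) - ln N).
    2:{ rewrite <- ln_div by lra. f_equal. field. lra. }
    replace (1 - x + N) with (N' - x) by lra.
    ring.
Qed.

Lemma is_lim_seq_ln_one_plus_div (c : R) :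
  is_lim_seq (fun n => ln (1 + c * / INR (S n))) 0.
Proof.
  replace (Finite 0) with (Finite (ln (1 + c * 0)))
    by (f_equal; rewrite Rmult_0_r, Rplus_0_r; apply ln_1).
  apply is_lim_seq_continuous.
  - apply derivable_continuous_pt. exists (/ (1 + c * 0)). apply derivable_pt_lim_ln. lra.
  - apply is_lim_seq_plus'; [apply is_lim_seq_const|].
    apply (is_lim_seq_scal_l _ c 0).
    exact is_lim_seq_inv_succ.
Qed.

(** This form of the sine product runs over the same [k <= n] as [log_beta], so the two can be
    combined term by term before passing to the limit. *)
Lemma ln_sine_lim (x : R) :
  0 < x < 1 ->
  is_lim_seq (fun n => sum_f_R0 (fun k => ln (x + INR k) + ln (1 - x + INR k)) n
                       - lnfact n - lnfact (S n))
             (ln (sin (PI * x) / PI)).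
Proof.
  intros Hx.
  assert (HPI := PI_RGT_0).
  assert (S0 : 0 < sin (PI * x)) by (apply sin_gt_0; nra).
  apply is_lim_seq_ext with
    (fun n => ln (sine_prod x (S n)) - ln PI - ln (1 + x * / INR (S n))).
  { intros n. rewrite (proj2 (sine_prod_log x n Hx)). unfold Rdiv. ring. }
  replace (ln (sin (PI * x) / PI)) with (ln (sin (PI * x)) - ln PI - 0)
    by (rewrite ln_div by assumption; ring).
  apply is_lim_seq_minus'; [apply is_lim_seq_minus'|].
  - apply is_lim_seq_continuous.
    + apply derivable_continuous_pt. exists (/ sin (PI * x)). now apply derivable_pt_lim_ln.
    + apply -> is_lim_seq_incr_1. now apply sine_prod_lim.
  - apply is_lim_seq_const.
  - apply is_lim_seq_ln_one_plus_div.
Qed.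

(** * The argument of [T_s] *)

Lemma cosh2_minus_sinh2 (a : R) : cosh a ^ 2 - sinh a ^ 2 = 1.
Proof.
  unfold cosh, sinh. assert (E : exp a * exp (- a) = 1).
  { rewrite <- exp_plus, Rplus_opp_r. apply exp_0. }
  transitivity (exp a * exp (- a)); [field | assumption].
Qed.

Lemma cosh_ge_1 (a : R) : 1 <= cosh a.
Proof.
  generalize (cosh2_minus_sinh2 a). intros H.
  assert (0 < cosh a).
  { unfold cosh. generalize (exp_pos a) (exp_pos (- a)). lra. }
  nra.
Qed.

Lemma sinh_double (a : R) : sinh (2 * a) = 2 * sinh a * cosh a.
Proof.
  unfold sinh, cosh. replace (2 * a) with (a + a) by ring.
  rewrite Ropp_plus_distr, !exp_plus. field.
Qed.

Lemma cosh_double (a : R) : cosh (2 * a) = cosh a ^ 2 + sinh a ^ 2.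
Proof.
  unfold sinh, cosh. replace (2 * a) with (a + a) by ring.
  rewrite Ropp_plus_distr, !exp_plus. field.
Qed.

Lemma sinh_opp (a : R) : sinh (- a) = - sinh a.
Proof. unfold sinh. rewrite Ropp_involutive. field. Qed.

Lemma cosh_opp (a : R) : cosh (- a) = cosh a.
Proof. unfold cosh. rewrite Ropp_involutive. field. Qed.

Lemma sinh_pos (a : R) : 0 < a -> 0 < sinh a.
Proof. intros H. rewrite <- sinh_0. now apply sinh_lt. Qed.

Lemma is_derive_sinh (a : R) : is_derive sinh a (cosh a).
Proof. apply is_derive_Reals, derivable_pt_lim_sinh. Qed.

Lemma is_derive_cosh (a : R) : is_derive cosh a (sinh a).
Proof. apply is_derive_Reals, derivable_pt_lim_cosh. Qed.

Lemma id_le_sinh (a : R) : 0 <= a -> a <= sinh a.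
Proof.
  intros Ha.
  assert (H : sinh 0 - 0 <= sinh a - a).
  { apply (nonneg_derive_le (fun s => sinh s - s) (fun s => cosh s - 1)); auto.
    - intros x _. apply (is_derive_minus (V := R_NormedModule)).
      + apply is_derive_sinh.
      + apply (is_derive_id (K := R_AbsRing)).
    - intros x _. generalize (cosh_ge_1 x). lra. }
  rewrite sinh_0 in H. lra.
Qed.

Lemma sinh_le_id_mul_cosh (a : R) : 0 <= a -> sinh a <= a * cosh a.
Proof.
  intros Ha.
  assert (H : 0 * cosh 0 - sinh 0 <= a * cosh a - sinh a).
  { apply (nonneg_derive_le (fun s => s * cosh s - sinh s) (fun s => s * sinh s)); auto.
    - intros x _.
      replace (x * sinh x) with ((1 * cosh x + x * sinh x) - cosh x) by ring.
      apply (is_derive_minus (V := R_NormedModule)); [|apply is_derive_sinh].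
      apply (is_derive_mult (fun s => s) cosh x 1 (sinh x)).
      + apply (is_derive_id (K := R_AbsRing)).
      + apply is_derive_cosh.
      + intros; apply Rmult_comm.
    - intros x Hx. generalize (sinh_pos x (proj1 Hx)). nra. }
  rewrite sinh_0 in H. lra.
Qed.

Lemma csin_pair (x y : R) : csin (x, y) = (sin x * cosh y, cos x * sinh y).
Proof.
  unfold csin, cexp, Cdiv, Cinv, Cmult, Cminus, Copp, Cplus, Ci, RtoC, Re, Im, cosh, sinh.
  cbn [fst snd].
  replace (0 * x - 1 * y) with (- y) by ring.
  replace (0 * y + 1 * x) with x by ring.
  rewrite Ropp_involutive, cos_neg, sin_neg. f_equal; field.
Qed.

Lemma T_s_quotient (alpha tau xi : R) :
  T_s alpha tau xi =
  Cdiv (sin (PI * (tau - alpha)) * cosh (PI * xi), cos (PI * (tau - alpha)) * sinh (PI * xi))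
       (sin (PI * (tau - 2 * alpha)) * cosh (PI * xi),
        cos (PI * (tau - 2 * alpha)) * sinh (PI * xi)).
Proof.
  assert (E : forall w, csin (Cmult (RtoC PI) (1 - w, - xi)) =
                (sin (PI * w) * cosh (PI * xi), cos (PI * w) * sinh (PI * xi))).
  { intros w.
    replace (Cmult (RtoC PI) (1 - w, - xi)) with ((PI - PI * w, - (PI * xi)) : C).
    - rewrite csin_pair, sinh_opp, cosh_opp, sin_minus, cos_minus, sin_PI, cos_PI.
      f_equal; ring.
    - unfold Cmult, RtoC; cbn [fst snd]. f_equal; ring. }
  unfold T_s.
  replace (1 - tau + alpha) with (1 - (tau - alpha)) by ring.
  replace (1 - tau + 2 * alpha) with (1 - (tau - 2 * alpha)) by ring.
  now rewrite !E.
Qed.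

(* Minus the [x]-derivative of the argument of [sin (t * (x + i * xi))]. *)
Definition poisson_kernel (xi t x : R) : R :=
  t * sinh (2 * t * xi) / (cosh (2 * t * xi) - cos (2 * t * x)).

Lemma cosh_minus_cos (a b : R) :
  cosh (2 * a) - cos (2 * b) = 2 * (sinh a ^ 2 + sin b ^ 2).
Proof.
  rewrite cosh_double, cos_2a_sin. generalize (cosh2_minus_sinh2 a). lra.
Qed.

Lemma cosh_minus_cos_pos (a b : R) : 0 < a -> 0 < cosh (2 * a) - cos (2 * b).
Proof.
  intros Ha. rewrite cosh_minus_cos. generalize (sinh_pos a Ha). nra.
Qed.

(** For [A = 2 t xi] and [B = 2 t x], [cosh 2A - cos 2B = 2 (cosh A - cos B) (cosh A + cos B)]. The
    shift by [PI / (2t)] changes the sign of [cos B], so the claim is a partial fraction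
    decomposition. *)
Lemma poisson_kernel_double (xi t x : R) :
  0 < xi -> 0 < t ->
  poisson_kernel xi (2 * t) x
  = poisson_kernel xi t x + poisson_kernel xi t (x + PI / (2 * t)).
Proof.
  intros Hxi Ht. unfold poisson_kernel.
  replace (2 * t * (x + PI / (2 * t))) with (2 * t * x + PI) by (field; lra).
  rewrite neg_cos.
  replace (2 * (2 * t) * xi) with (2 * (2 * t * xi)) by ring.
  replace (2 * (2 * t) * x) with (2 * (2 * t * x)) by ring.
  assert (P : 1 < cosh (2 * t * xi)).
  { generalize (cosh2_minus_sinh2 (2 * t * xi)) (cosh_ge_1 (2 * t * xi))
      (sinh_pos (2 * t * xi) ltac:(nra)). nra. }
  assert (B := COS_bound (2 * t * x)).
  rewrite sinh_double, cosh_double, cos_2a_cos.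
  replace (cosh (2 * t * xi) ^ 2 + sinh (2 * t * xi) ^ 2
           - (2 * cos (2 * t * x) * cos (2 * t * x) - 1))
    with (2 * (cosh (2 * t * xi) - cos (2 * t * x)) * (cosh (2 * t * xi) + cos (2 * t * x)))
    by (generalize (cosh2_minus_sinh2 (2 * t * xi)); lra).
  field. split; lra.
Qed.

(** With [a = t xi] and [b = t x], cross-multiplication and [sin b ^ 2 <= b ^ 2] leave two
    comparisons: [sinh a <= a cosh a] for the terms in [a^2], and [a <= sinh a cosh a] for those in
    [b^2]. *)
Lemma poisson_kernel_ge (xi t x : R) :
  0 < xi -> 0 < t -> xi / (x ^ 2 + xi ^ 2) <= poisson_kernel xi t x.
Proof.
  intros Hxi Ht. unfold poisson_kernel.
  replace (2 * t * xi) with (2 * (t * xi)) by ring.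
  replace (2 * t * x) with (2 * (t * x)) by ring.
  rewrite sinh_double, cosh_minus_cos.
  set (a := t * xi). set (b := t * x).
  assert (Ha : 0 < a) by (unfold a; nra).
  assert (S0 := sinh_pos a Ha).
  assert (S1 := id_le_sinh a ltac:(lra)).
  assert (S2 := sinh_le_id_mul_cosh a ltac:(lra)).
  assert (S3 := cosh_ge_1 a).
  assert (S4 := sin_sqr_le b).
  assert (DS : 0 < sinh a ^ 2 + sin b ^ 2)
    by (generalize (pow_lt _ 2 S0) (pow2_ge_0 (sin b)); lra).
  assert (DA : 0 < a ^ 2 + b ^ 2) by (generalize (pow_lt _ 2 Ha) (pow2_ge_0 b); lra).
  replace (xi / (x ^ 2 + xi ^ 2)) with (t * (a / (a ^ 2 + b ^ 2))).
  2:{ assert (0 < x ^ 2 + xi ^ 2) by nra. assert (0 < t ^ 2) by nra.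
      unfold a, b. field. repeat split; try lra.
      replace ((t * xi) ^ 2 + (t * x) ^ 2) with (t ^ 2 * (x ^ 2 + xi ^ 2)) by ring. nra. }
  replace (t * (2 * sinh a * cosh a) / (2 * (sinh a ^ 2 + sin b ^ 2)))
    with (t * (sinh a * cosh a / (sinh a ^ 2 + sin b ^ 2))) by (field; lra).
  apply Rmult_le_compat_l; [lra|].
  apply (proj1 (Rle_div_r _ _ _ DS)).
  replace (a / (a ^ 2 + b ^ 2) * (sinh a ^ 2 + sin b ^ 2))
    with (a * (sinh a ^ 2 + sin b ^ 2) / (a ^ 2 + b ^ 2)) by (field; lra).
  apply (proj2 (Rle_div_l _ _ _ DA)).
  apply Rle_trans with (a * sinh a ^ 2 + a * b ^ 2); [nra|].
  rewrite Rmult_plus_distr_l. apply Rplus_le_compat.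
  - replace (a * sinh a ^ 2) with (a * sinh a * sinh a) by ring.
    replace (sinh a * cosh a * a ^ 2) with (a * sinh a * (a * cosh a)) by ring.
    apply Rmult_le_compat_l; nra.
  - apply Rmult_le_compat_r; nra.
Qed.

(** * Lower bounds of the kernel by sums over translates *)

Lemma sum_sqr_pos (y xi : R) : 0 < xi -> 0 < y ^ 2 + xi ^ 2.
Proof. intros H. generalize (pow_lt xi 2 H) (pow2_ge_0 y). lra. Qed.

Lemma sum_pairs (f : nat -> R) (n : nat) :
  sum_f_R0 f (2 * n + 1) =
  sum_f_R0 (fun k => f (2 * k)%nat) n + sum_f_R0 (fun k => f (2 * k + 1)%nat) n.
Proof.
  induction n as [|n IH]; [simpl; ring|].
  replace (2 * S n + 1)%nat with (S (S (2 * n + 1))) by lia.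
  rewrite !tech5, IH.
  replace (S (2 * n + 1)) with (2 * S n)%nat by lia.
  replace (S (2 * S n)) with (2 * S n + 1)%nat by lia. ring.
Qed.

(** Duplication splits the kernel for [t] into two kernels for [t / 2]. Their translates by
    multiples of [2 PI / t] are the even and the odd translates by multiples of [PI / t]; a single
    term is [poisson_kernel_ge]. *)
Lemma poisson_kernel_dyadic (xi : R) (i : nat) :
  0 < xi -> forall t x, 0 < t ->
  sum_f_R0 (fun k => xi / ((x + INR k * (PI / t)) ^ 2 + xi ^ 2)) (2 ^ i - 1)
  <= poisson_kernel xi t x.
Proof.
  intros Hxi. induction i as [|i IH]; intros t x Ht.
  - simpl. rewrite Rmult_0_l, Rplus_0_r. now apply poisson_kernel_ge.
  - assert (Hp : (1 <= 2 ^ i)%nat) by (apply (Nat.pow_le_mono_r 2 0 i); lia).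
    replace (2 ^ S i - 1)%nat with (2 * (2 ^ i - 1) + 1)%nat by (simpl; lia).
    rewrite sum_pairs.
    replace (poisson_kernel xi t x) with (poisson_kernel xi (2 * (t / 2)) x)
      by (f_equal; field).
    rewrite poisson_kernel_double by lra.
    apply Rplus_le_compat.
    + eapply Rle_trans; [right | apply (IH (t / 2) x); lra].
      apply sum_eq. intros k _. rewrite mult_INR. change (INR 2) with 2.
      replace (x + 2 * INR k * (PI / t)) with (x + INR k * (PI / (t / 2))) by (field; lra).
      reflexivity.
    + eapply Rle_trans; [right | apply (IH (t / 2)); lra].
      apply sum_eq. intros k _. rewrite plus_INR, mult_INR. change (INR 2) with 2. change (INR 1) with 1.
      replace (x + (2 * INR k + 1) * (PI / t))
        with (x + PI / (2 * (t / 2)) + INR k * (PI / (t / 2))) by (field; lra).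
      reflexivity.
Qed.

Lemma sum_f_R0_le_ext (f : nat -> R) (m n : nat) :
  (forall k, 0 <= f k) -> (m <= n)%nat -> sum_f_R0 f m <= sum_f_R0 f n.
Proof.
  intros Hf. induction 1 as [|n _ IH]; [lra|].
  rewrite tech5. generalize (Hf (S n)). lra.
Qed.

Lemma sum_symmetric (f : R -> R) (x : R) (n : nat) :
  sum_f_R0 (fun k => f (x - INR n + INR k)) (2 * n + 1) =
  sum_f_R0 (fun k => f (x - INR k)) n + sum_f_R0 (fun k => f (x + INR k + 1)) n.
Proof.
  replace (2 * n + 1)%nat with (n + S n)%nat by lia.
  rewrite (tech2 _ n) by lia. f_equal.
  - rewrite <- sum_f_R0_skip. apply sum_eq. intros k Hk.
    rewrite minus_INR by lia. f_equal. ring.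
  - replace (n + S n - S n)%nat with n by lia.
    apply sum_eq. intros k _. rewrite plus_INR, S_INR. f_equal. ring.
Qed.

(** For [t = PI] the translates have step [1] and the kernel has period [1] in [x]. The dyadic bound
    can thus start at [x - n], and [2 ^ (2n+2)] terms cover the window from [x - n] to
    [x + n + 1]. *)
Lemma poisson_kernel_ge_sum (xi x : R) (n : nat) :
  0 < xi ->
  sum_f_R0 (fun k => xi / ((x - INR k) ^ 2 + xi ^ 2)) n
  + sum_f_R0 (fun k => xi / ((x + INR k + 1) ^ 2 + xi ^ 2)) n
  <= poisson_kernel xi PI x.
Proof.
  intros Hxi.
  assert (HPI := PI_RGT_0).
  rewrite <- (sum_symmetric (fun y => xi / (y ^ 2 + xi ^ 2)) x n).
  replace (poisson_kernel xi PI x) with (poisson_kernel xi PI (x - INR n)).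
  - eapply Rle_trans; [|apply (poisson_kernel_dyadic xi (2 * n + 2) Hxi PI _ HPI)].
    rewrite (sum_eq _ (fun k => xi / ((x - INR n + INR k) ^ 2 + xi ^ 2)) (2 ^ _ - 1)).
    + apply sum_f_R0_le_ext.
      * intros k. apply Rlt_le, Rdiv_lt_0_compat; [lra | now apply sum_sqr_pos].
      * generalize (Nat.pow_gt_lin_r 2 (2 * n + 2)). lia.
    + intros k _. repeat f_equal. field. lra.
  - unfold poisson_kernel.
    replace (cos (2 * PI * x)) with (cos (2 * PI * (x - INR n) + 2 * INR n * PI)).
    + now rewrite cos_period.
    + f_equal. ring.
Qed.

(** * Integration of the kernel bound to the argument of [T_s] *)

Definition atan_sum (xi : R) (n : nat) (y : R) : R :=
  sum_f_R0 (fun k => atan ((y - INR k) / xi)) n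
  + sum_f_R0 (fun k => atan ((y + INR k + 1) / xi)) n.

Lemma is_derive_sum_f_R0 (f df : nat -> R -> R) (y : R) (n : nat) :
  (forall k, is_derive (f k) y (df k y)) ->
  is_derive (fun z => sum_f_R0 (fun k => f k z) n) y (sum_f_R0 (fun k => df k y) n).
Proof.
  intros H. induction n as [|n IH]; [apply H|].
  apply (is_derive_plus (V := R_NormedModule) (fun z => sum_f_R0 (fun k => f k z) n)); auto.
Qed.

(** [atan_sum] is chosen as a primitive of the lower bound in [poisson_kernel_ge_sum]. *)
Lemma is_derive_atan_sum (xi : R) (n : nat) (y : R) :
  0 < xi ->
  is_derive (atan_sum xi n) y
    (sum_f_R0 (fun k => xi / ((y - INR k) ^ 2 + xi ^ 2)) n
     + sum_f_R0 (fun k => xi / ((y + INR k + 1) ^ 2 + xi ^ 2)) n).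
Proof.
  intros Hxi.
  apply (is_derive_plus (V := R_NormedModule)).
  - apply (is_derive_sum_f_R0 (fun k z => atan ((z - INR k) / xi))
      (fun k z => xi / ((z - INR k) ^ 2 + xi ^ 2))).
    intros k. assert (P := sum_sqr_pos (y - INR k) xi Hxi).
    auto_derive; auto. field. split; lra.
  - apply (is_derive_sum_f_R0 (fun k z => atan ((z + INR k + 1) / xi))
      (fun k z => xi / ((z + INR k + 1) ^ 2 + xi ^ 2))).
    intros k. assert (P := sum_sqr_pos (y + INR k + 1) xi Hxi).
    auto_derive; auto. field. split; lra.
Qed.

(* Cotangent of [- arg T_s], for [v = tau - 2 alpha] and [s = alpha]. *)
Definition cot_arg_T_s (xi v s : R) : R :=
  (cos (PI * s) * cosh (2 * PI * xi) - cos (PI * (2 * v + s)))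
  / (sin (PI * s) * sinh (2 * PI * xi)).

(** [PI / 2 - atan] is the arccotangent with values in [(0, PI)]. With the cotangent written
    [X / Y], [X^2 + Y^2] factors as in [ID], and its factor without [s] cancels the numerator that
    the quotient rule produces. *)
Lemma is_derive_arccot_arg_T_s (xi v s : R) :
  0 < xi -> 0 < s < 1 ->
  is_derive (fun r => PI / 2 - atan (cot_arg_T_s xi v r)) s (poisson_kernel xi PI (v + s)).
Proof.
  intros Hxi Hs.
  assert (HPI := PI_RGT_0).
  assert (S0 : 0 < sin (PI * s)) by (apply sin_gt_0; nra).
  assert (Sh : 0 < sinh (2 * PI * xi)) by (apply sinh_pos; nra).
  assert (P1 : 0 < cosh (2 * PI * xi) - cos (2 * PI * (v + s))).
  { replace (2 * PI * xi) with (2 * (PI * xi)) by ring.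
    replace (2 * PI * (v + s)) with (2 * (PI * (v + s))) by ring.
    apply cosh_minus_cos_pos. nra. }
  assert (P2 : 0 < cosh (2 * PI * xi) - cos (2 * PI * v)).
  { replace (2 * PI * xi) with (2 * (PI * xi)) by ring.
    replace (2 * PI * v) with (2 * (PI * v)) by ring.
    apply cosh_minus_cos_pos. nra. }
  assert (CS := cosh2_minus_sinh2 (2 * PI * xi)).
  unfold cot_arg_T_s, poisson_kernel.
  set (ch := cosh (2 * PI * xi)) in *. set (sh := sinh (2 * PI * xi)) in *.
  assert (ID : sin (PI * s) ^ 2 * sh ^ 2 + (cos (PI * s) * ch - cos (PI * (2 * v + s))) ^ 2
     = (ch - cos (2 * PI * (v + s))) * (ch - cos (2 * PI * v))).
  { replace (sh ^ 2) with (ch ^ 2 - 1) by lra.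
    replace (PI * (2 * v + s)) with (PI * s + 2 * PI * v) by ring.
    replace (2 * PI * (v + s)) with (2 * (PI * s) + 2 * PI * v) by ring.
    rewrite !cos_plus, cos_2a, sin_2a.
    generalize (sin2_cos2 (PI * s)) (sin2_cos2 (2 * PI * v)). unfold Rsqr.
    set (sa := sin (PI * s)). set (ca := cos (PI * s)).
    set (sb := sin (2 * PI * v)). set (cb := cos (2 * PI * v)). intros E1 E2.
    apply Rminus_diag_uniq.
    transitivity ((sa * sa + ca * ca - 1) * (ch ^ 2 - ch * cb)
                  + sa ^ 2 * (sb * sb + cb * cb - 1)); [ring|].
    rewrite E1, E2. ring. }
  assert (IC : sin (PI * (2 * v + s)) * sin (PI * s) + cos (PI * (2 * v + s)) * cos (PI * s)
     = cos (2 * PI * v)).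
  { replace (2 * PI * v) with (PI * (2 * v + s) - PI * s) by ring. rewrite cos_minus. ring. }
  set (X := cos (PI * s) * ch - cos (PI * (2 * v + s))) in *.
  set (Y := sin (PI * s) * sh).
  assert (HY : 0 < Y) by (unfold Y; nra).
  replace (PI * sh / (ch - cos (2 * PI * (v + s))))
    with (- ((PI * (cos (2 * PI * v) - ch) * sh / Y ^ 2) / (1 + (X / Y) ^ 2))).
  2:{ replace (1 + (X / Y) ^ 2) with ((ch - cos (2 * PI * (v + s))) * (ch - cos (2 * PI * v)) / Y ^ 2).
      - field. repeat split; lra.
      - rewrite <- ID. unfold Y. field. split; lra. }
  assert (DK : is_derive (fun r => (cos (PI * r) * ch - cos (PI * (2 * v + r)))
                         / (sin (PI * r) * sh)) s
                 (PI * (cos (2 * PI * v) - ch) * sh / Y ^ 2)).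
  { auto_derive; [unfold Y in HY; lra|].
    rewrite <- IC.
    assert (E1 : ch = ch * (sin (PI * s) * sin (PI * s) + cos (PI * s) * cos (PI * s))).
    { generalize (sin2_cos2 (PI * s)). unfold Rsqr. intros ->. ring. }
    rewrite E1 at 3. unfold Y. field. split; lra. }
  replace (- _) with (0 - PI * (cos (2 * PI * v) - ch) * sh / Y ^ 2 * / (1 + (X / Y) ^ 2))
    by (unfold Rdiv; ring).
  apply (is_derive_minus (V := R_NormedModule)); [apply (is_derive_const (V := R_NormedModule))|].
  apply (is_derive_comp (V := R_NormedModule) atan); [|exact DK].
  apply is_derive_Reals.
  apply (derivable_pt_lim_atan (X / Y)).
Qed.

(** The derivatives in [s] are ordered and both sides tend to [0] as [s] decreases to [0], but at
    [s = 0] the cotangent is a division by zero. So a deficit [e] at [s] is carried down to a small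
    [r > 0] where [atan_sum] has grown by less than [e]; there the arccotangent would be
    negative. *)
Lemma arccot_arg_T_s_ge (xi v s : R) (n : nat) :
  0 < xi -> 0 < s < 1 ->
  atan_sum xi n (v + s) - atan_sum xi n v <= PI / 2 - atan (cot_arg_T_s xi v s).
Proof.
  intros Hxi Hs.
  apply Rnot_lt_le. intros Hlt.
  set (e := atan_sum xi n (v + s) - atan_sum xi n v - (PI / 2 - atan (cot_arg_T_s xi v s))).
  assert (He : 0 < e) by (unfold e; lra).
  assert (Hc : continuity_pt (atan_sum xi n) v).
  { apply derivable_continuous_pt. eexists.
    apply is_derive_Reals, is_derive_atan_sum, Hxi. }
  destruct (Hc e He) as [d [Hd Hcd]].
  set (r := Rmin (d / 2) (s / 2)).
  assert (Hr : 0 < r /\ r < d /\ r < s).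
  { unfold r. generalize (Rmin_l (d / 2) (s / 2)) (Rmin_r (d / 2) (s / 2)).
    intros H1 H2. split; [apply Rmin_glb_lt; lra | lra]. }
  assert (Hn : atan_sum xi n (v + r) - atan_sum xi n v < e).
  { specialize (Hcd (v + r)). unfold dist, D_x, no_cond in Hcd; simpl in Hcd.
    unfold Rdist in Hcd.
    eapply Rle_lt_trans; [apply Rle_abs | apply Hcd].
    split; [split; [exact I | lra]|].
    replace (v + r - v) with r by ring. rewrite Rabs_pos_eq; lra. }
  assert (Hm : PI / 2 - atan (cot_arg_T_s xi v r) - atan_sum xi n (v + r)
               <= PI / 2 - atan (cot_arg_T_s xi v s) - atan_sum xi n (v + s)).
  { apply (nonneg_derive_le
      (fun q => PI / 2 - atan (cot_arg_T_s xi v q) - atan_sum xi n (v + q))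
      (fun q => poisson_kernel xi PI (v + q)
         - 1 * (sum_f_R0 (fun k => xi / ((v + q - INR k) ^ 2 + xi ^ 2)) n
            + sum_f_R0 (fun k => xi / ((v + q + INR k + 1) ^ 2 + xi ^ 2)) n))); [lra| |].
    - intros q Hq. apply (is_derive_minus (V := R_NormedModule)).
      + apply is_derive_arccot_arg_T_s; lra.
      + apply (is_derive_comp (V := R_NormedModule) (atan_sum xi n) (fun z => v + z)).
        * now apply is_derive_atan_sum.
        * auto_derive; auto.
    - intros q Hq. generalize (poisson_kernel_ge_sum xi (v + q) n Hxi). lra. }
  generalize (atan_bound (cot_arg_T_s xi v r)). unfold e in Hn. lra.
Qed.

(** Multiplying by the conjugate of the denominator, whose squared modulus is [D], gives
    [T_s = (X - i Y) / (2 D)] with [Y > 0]. *)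
Lemma T_s_polar (alpha tau xi : R) :
  0 < alpha < 1 / 2 -> 0 < xi ->
  exists r, 0 < r /\
  T_s alpha tau xi = polar r (- (PI / 2 - atan (cot_arg_T_s xi (tau - 2 * alpha) alpha))).
Proof.
  intros Ha Hxi.
  assert (HPI := PI_RGT_0).
  set (v := tau - 2 * alpha).
  set (X := cos (PI * alpha) * cosh (2 * PI * xi) - cos (PI * (2 * v + alpha))).
  set (Y := sin (PI * alpha) * sinh (2 * PI * xi)).
  assert (HY : 0 < Y).
  { apply Rmult_lt_0_compat; [apply sin_gt_0; nra | apply sinh_pos; nra]. }
  set (D := (sin (PI * v) * cosh (PI * xi)) ^ 2 + (cos (PI * v) * sinh (PI * xi)) ^ 2).
  assert (HD : 0 < D).
  { assert (Hs := sinh_pos (PI * xi) ltac:(nra)).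
    generalize (cosh2_minus_sinh2 (PI * xi)) (sin2_cos2 (PI * v)). unfold D, Rsqr.
    intros E1 E2. rewrite !Rpow_mult_distr.
    replace (cosh (PI * xi) ^ 2) with (1 + sinh (PI * xi) ^ 2) by lra.
    nra. }
  exists (exp (/ 2 * ln (Y ^ 2 + X ^ 2)) / (2 * D)).
  split; [apply Rdiv_lt_0_compat; [apply exp_pos | lra]|].
  (* The coordinates are swapped because [Y] is the positive one: [X - i Y = - i (Y + i X)], a
     rotation by [- PI / 2]. *)
  assert (E := polar_of_right_half_plane Y X HY).
  unfold polar in E. injection E as EY EX.
  unfold cot_arg_T_s. fold v X Y.
  unfold polar.
  rewrite cos_neg, sin_neg, cos_shift, sin_shift.
  set (r := exp _) in *. set (A := atan _) in *.
  replace (r / (2 * D) * sin A) with (r * sin A / (2 * D)) by (field; lra).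
  replace (r / (2 * D) * - cos A) with (- (r * cos A) / (2 * D)) by (field; lra).
  rewrite <- EX, <- EY.
  rewrite T_s_quotient. fold v.
  unfold Cdiv, Cinv, Cmult; cbn [fst snd]. fold D.
  unfold X, Y.
  replace (2 * PI * xi) with (2 * (PI * xi)) by ring.
  rewrite sinh_double, cosh_double.
  replace (PI * (tau - alpha)) with (PI * v + PI * alpha) by (unfold v; ring).
  replace (PI * (2 * v + alpha)) with (2 * (PI * v) + PI * alpha) by ring.
  rewrite !sin_plus, !cos_plus, cos_2a, sin_2a.
  assert (E1 := cosh2_minus_sinh2 (PI * xi)).
  assert (E2 := sin2_cos2 (PI * v)). unfold Rsqr in E2.
  set (ch := cosh (PI * xi)) in *. set (sh := sinh (PI * xi)) in *.
  set (sv := sin (PI * v)) in *. set (cv := cos (PI * v)) in *.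
  set (sa := sin (PI * alpha)). set (ca := cos (PI * alpha)).
  f_equal.
  - apply Rmult_eq_reg_r with (2 * D); [|lra].
    transitivity (2 * ((sv * ca + cv * sa) * ch * (sv * ch) + (cv * ca - sv * sa) * sh * (cv * sh)));
      [field; lra|].
    transitivity (ca * (ch ^ 2 + sh ^ 2) - ((cv * cv - sv * sv) * ca - 2 * sv * cv * sa));
      [|field; lra].
    (* Inserting [sv^2 + cv^2 = 1] and [ch^2 - sh^2 = 1] makes the right side homogeneous, so that a
       polynomial identity remains. *)
    replace (ca * (ch ^ 2 + sh ^ 2)) with (ca * (ch ^ 2 + sh ^ 2) * (sv * sv + cv * cv))
      by (rewrite E2; ring).
    replace ((cv * cv - sv * sv) * ca - 2 * sv * cv * sa)
      with (((cv * cv - sv * sv) * ca - 2 * sv * cv * sa) * (ch ^ 2 - sh ^ 2))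
      by (rewrite E1; ring).
    ring.
  - apply Rmult_eq_reg_r with D; [|lra].
    transitivity ((cv * ca - sv * sa) * sh * (sv * ch) - (sv * ca + cv * sa) * ch * (cv * sh));
      [field; lra|].
    transitivity (- (sa * sh * ch) * (sv * sv + cv * cv)); [ring | rewrite E2; field; lra].
Qed.

(** * Comparison of [T_s] and [T_B] *)

Definition log_beta (alpha tau xi : R) (n : nat) : R :=
  lnfact n
  + sum_f_R0 (fun k => / 2 * ln ((tau + 1 + INR k) ^ 2 + xi ^ 2)
                       - / 2 * ln ((tau - 2 * alpha + 1 + INR k) ^ 2 + xi ^ 2)
                       - ln (2 * alpha + INR k)) n.

Definition arg_beta (alpha tau xi : R) (n : nat) : R :=
  sum_f_R0 (fun k => atan (xi / (tau + 1 + INR k))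
                     - atan (xi / (tau - 2 * alpha + 1 + INR k))) n.

Lemma half_ln_sqr (y : R) : 0 < y -> / 2 * ln (y ^ 2 + 0 ^ 2) = ln y.
Proof.
  intros Hy. replace (y ^ 2 + 0 ^ 2) with (y * y) by ring.
  rewrite ln_mult by assumption. field.
Qed.

(* The powers of [n] in the three Gauss products cancel. *)
Lemma T_B_polar (alpha tau xi : R) :
  0 < alpha < 1 / 2 -> 0 < tau < 1 ->
  exists l t : R,
    is_lim_seq (log_beta alpha tau xi) l /\ is_lim_seq (arg_beta alpha tau xi) t /\
    T_B alpha tau xi = polar (sin (PI * alpha) / PI * exp l) t.
Proof.
  intros Ha Ht.
  destruct (CGamma_polar (tau - 2 * alpha + 1) xi ltac:(lra)) as (l1 & t1 & Hl1 & Ht1 & E1).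
  destruct (CGamma_polar (2 * alpha) 0 ltac:(lra)) as (l2 & t2 & Hl2 & Ht2 & E2).
  destruct (CGamma_polar (tau + 1) xi ltac:(lra)) as (l3 & t3 & Hl3 & Ht3 & E3).
  exists (l1 + l2 - l3), (t1 + t2 - t3). repeat split.
  - apply is_lim_seq_ext with (fun n => log_mod_gauss (tau - 2 * alpha + 1) xi n
      + log_mod_gauss (2 * alpha) 0 n - log_mod_gauss (tau + 1) xi n).
    + intros n. unfold log_mod_gauss, log_beta. rewrite !minus_sum.
      rewrite (sum_eq (fun k => / 2 * ln ((2 * alpha + INR k) ^ 2 + 0 ^ 2))
                      (fun k => ln (2 * alpha + INR k))).
      * ring.
      * intros k _. apply half_ln_sqr. generalize (pos_INR k). lra.
    + apply is_lim_seq_minus'; [apply is_lim_seq_plus'|]; assumption.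
  - apply is_lim_seq_ext with (fun n => arg_gauss (tau - 2 * alpha + 1) xi n
      + arg_gauss (2 * alpha) 0 n - arg_gauss (tau + 1) xi n).
    + intros n. unfold arg_gauss, arg_beta. rewrite minus_sum.
      rewrite (sum_eq (fun k => atan (0 / (2 * alpha + INR k))) (fun _ => 0)).
      * rewrite sum_cte. ring.
      * intros k _. unfold Rdiv. rewrite Rmult_0_l. apply atan_0.
    + apply is_lim_seq_minus'; [apply is_lim_seq_plus'|]; assumption.
  - unfold T_B, CBeta.
    replace (Cplus (tau - 2 * alpha + 1, xi) (RtoC (2 * alpha))) with ((tau + 1, xi) : C)
      by (unfold Cplus, RtoC; cbn [fst snd]; f_equal; ring).
    change (RtoC (2 * alpha)) with ((2 * alpha, 0) : C).
    rewrite E1, E2, E3, polar_mult, polar_div, polar_real, polar_mult by apply exp_pos.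
    replace (exp (l1 + l2 - l3)) with (exp l1 * exp l2 / exp l3).
    + f_equal. ring.
    + unfold Rminus, Rdiv. now rewrite !exp_plus, exp_Ropp.
Qed.

Lemma T_B_modulus_pos (alpha l : R) :
  0 < alpha < 1 / 2 -> 0 < sin (PI * alpha) / PI * exp l.
Proof.
  intros Ha. assert (HPI := PI_RGT_0).
  apply Rmult_lt_0_compat; [|apply exp_pos].
  apply Rdiv_lt_0_compat; [apply sin_gt_0; nra | assumption].
Qed.

(** * Ordering of the arguments *)

Lemma atan_gap (x y c : R) :
  x < y -> 0 < x + y -> 0 < c -> atan (y + c) - atan y < atan (x + c) - atan x.
Proof.
  intros H1 H2 Hc.
  assert (H : atan (x + 0) - atan (y + 0) < atan (x + c) - atan (y + c)).
  { apply (pos_derive_lt (fun s => atan (x + s) - atan (y + s))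
      (fun s => / (1 + (x + s) ^ 2) - / (1 + (y + s) ^ 2))); [assumption| |].
    - intros s _. generalize (pow2_ge_0 (x + s)) (pow2_ge_0 (y + s)). intros P1 P2.
      auto_derive; auto. field. split; lra.
    (* From [x < y] and [0 < x + y], [|x + s| < |y + s|], so [atan] is steeper at [x + s]. *)
    - intros s Hs. generalize (pow2_ge_0 (x + s)) (pow2_ge_0 (y + s)). intros P1 P2.
      apply (proj2 (Rlt_0_minus _ _)), Rinv_lt_contravar; [apply Rmult_lt_0_compat; lra | nra]. }
  rewrite !Rplus_0_r in H. lra.
Qed.

Lemma atan_inv_quotient (xi y : R) :
  0 < xi -> 0 < y -> atan (xi / y) = PI / 2 - atan (y / xi).
Proof.
  intros Hxi Hy. replace (xi / y) with (/ (y / xi)) by (field; lra).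
  apply atan_inv. now apply Rdiv_lt_0_compat.
Qed.

(** The [k]-th term of the increment of [atan_sum] plus that of [arg_beta], after
    [atan ((tau - 2 alpha + k + 1) / xi)] has cancelled: a difference of two increments of [atan]
    over intervals of equal length. *)
Definition arg_gap (alpha tau xi : R) (k : nat) : R :=
  (atan ((tau - alpha - INR k) / xi) - atan ((tau - 2 * alpha - INR k) / xi))
  - (atan ((tau + 1 + INR k) / xi) - atan ((tau - alpha + INR k + 1) / xi)).

(* Reflecting [tau - 2 alpha - k, tau - alpha - k] through [0] brings it closer
   to the origin than [tau - alpha + k + 1, tau + k + 1]. *)
Lemma arg_gap_pos (alpha tau xi : R) (k : nat) :
  0 < alpha < 1 / 2 -> 0 < tau < 1 -> 0 < xi -> 0 < arg_gap alpha tau xi k.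
Proof.
  intros Ha Ht Hxi. assert (Hk := pos_INR k).
  assert (Hi := Rinv_0_lt_compat _ Hxi).
  assert (G := atan_gap ((INR k + alpha - tau) / xi) ((tau - alpha + INR k + 1) / xi)
                 (alpha / xi)).
  unfold arg_gap.
  replace ((tau - alpha - INR k) / xi) with (- ((INR k + alpha - tau) / xi)) by (field; lra).
  replace ((tau - 2 * alpha - INR k) / xi)
    with (- ((INR k + alpha - tau) / xi + alpha / xi)) by (field; lra).
  replace ((tau + 1 + INR k) / xi)
    with ((tau - alpha + INR k + 1) / xi + alpha / xi) by (field; lra).
  rewrite !atan_opp.
  assert (atan ((tau - alpha + INR k + 1) / xi + alpha / xi)
          - atan ((tau - alpha + INR k + 1) / xi)
          < atan ((INR k + alpha - tau) / xi + alpha / xi) - atan ((INR k + alpha - tau) / xi)).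
  { apply G.
    - unfold Rdiv. apply Rmult_lt_compat_r; lra.
    - rewrite <- Rdiv_plus_distr. apply Rdiv_lt_0_compat; lra.
    - apply Rdiv_lt_0_compat; lra. }
  lra.
Qed.

Lemma atan_sum_arg_beta (alpha tau xi : R) (n : nat) :
  0 < alpha < 1 / 2 -> 0 < tau < 1 -> 0 < xi ->
  atan_sum xi n (tau - 2 * alpha + alpha) - atan_sum xi n (tau - 2 * alpha)
  + arg_beta alpha tau xi n = sum_f_R0 (arg_gap alpha tau xi) n.
Proof.
  intros Ha Ht Hxi. unfold atan_sum, arg_beta.
  replace (tau - 2 * alpha + alpha) with (tau - alpha) by ring.
  assert (T : forall k, arg_gap alpha tau xi k
    = atan ((tau - alpha - INR k) / xi) + atan ((tau - alpha + INR k + 1) / xi)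
      - (atan ((tau - 2 * alpha - INR k) / xi) + atan ((tau - 2 * alpha + INR k + 1) / xi))
      + (atan (xi / (tau + 1 + INR k)) - atan (xi / (tau - 2 * alpha + 1 + INR k)))).
  { intros k. assert (Hk := pos_INR k). unfold arg_gap.
    rewrite (atan_inv_quotient xi (tau + 1 + INR k)),
      (atan_inv_quotient xi (tau - 2 * alpha + 1 + INR k)) by lra.
    replace (tau - 2 * alpha + INR k + 1) with (tau - 2 * alpha + 1 + INR k) by ring. ring. }
  induction n as [|n IH].
  - simpl sum_f_R0. rewrite T. simpl. ring.
  - rewrite !tech5, <- IH, T. ring.
Qed.

(** Each partial sum of [arg_beta] is at least the sum of the gaps minus [d]. All gaps are positive,
    so keeping the one for [k = 0] preserves strictness in the limit; likewise the first, negative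
    term of [arg_beta] bounds [t] from above. *)
Lemma args_ordered (alpha tau xi t : R) :
  0 < alpha < 1 / 2 -> 0 < tau < 1 -> 0 < xi ->
  is_lim_seq (arg_beta alpha tau xi) t ->
  - PI < - (PI / 2 - atan (cot_arg_T_s xi (tau - 2 * alpha) alpha)) < t /\ t < 0.
Proof.
  intros Ha Ht Hxi Hl.
  set (d := PI / 2 - atan (cot_arg_T_s xi (tau - 2 * alpha) alpha)).
  assert (Hd : d < PI).
  { unfold d. generalize (atan_bound (cot_arg_T_s xi (tau - 2 * alpha) alpha)). lra. }
  assert (G0 := arg_gap_pos alpha tau xi 0 Ha Ht Hxi).
  assert (L : Rbar_le (arg_gap alpha tau xi 0 - d) t).
  { apply is_lim_seq_le with (fun _ => arg_gap alpha tau xi 0 - d) (arg_beta alpha tau xi);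
      [|apply is_lim_seq_const | assumption].
    intros n.
    assert (A := arccot_arg_T_s_ge xi (tau - 2 * alpha) alpha n Hxi ltac:(lra)).
    assert (B := atan_sum_arg_beta alpha tau xi n Ha Ht Hxi).
    assert (C := sum_f_R0_le_ext (arg_gap alpha tau xi) 0 n
      (fun k => Rlt_le _ _ (arg_gap_pos alpha tau xi k Ha Ht Hxi)) (Nat.le_0_l n)).
    simpl in C. fold d in A. lra. }
  set (b := fun k => atan (xi / (tau + 1 + INR k))
                     - atan (xi / (tau - 2 * alpha + 1 + INR k))).
  assert (Hb : forall k, b k < 0).
  { intros k. assert (Hk := pos_INR k). unfold b. apply Rlt_minus, atan_increasing.
    unfold Rdiv. apply Rmult_lt_compat_l; [assumption|].
    apply Rinv_lt_contravar; [apply Rmult_lt_0_compat|]; lra. }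
  assert (U : Rbar_le t (b 0%nat)).
  { apply is_lim_seq_le with (arg_beta alpha tau xi) (fun _ => b 0%nat);
      [|assumption | apply is_lim_seq_const].
    intros n. induction n as [|n IH]; [apply Rle_refl|].
    unfold arg_beta in *. rewrite tech5. generalize (Hb (S n)). unfold b in *. lra. }
  simpl in L, U. generalize (Hb 0%nat). lra.
Qed.

Lemma T_s_T_B_args (alpha tau xi : R) :
  0 < alpha < 1 / 2 -> 0 < tau < 1 -> 0 < xi ->
  carg (T_s alpha tau xi) < carg (T_B alpha tau xi).
Proof.
  intros Ha Ht Hxi.
  destruct (T_s_polar alpha tau xi Ha Hxi) as (r & Hr & ->).
  destruct (T_B_polar alpha tau xi Ha Ht) as (l & t & _ & Hlt & ->).
  assert (A := args_ordered alpha tau xi t Ha Ht Hxi Hlt).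
  rewrite !carg_polar; try lra. now apply T_B_modulus_pos.
Qed.

(** * The moduli for [xi >= 1 / 4] *)

Lemma ln_modulus_quotient_le (p q P Q xi : R) :
  0 < Q <= q -> 0 <= p - q -> p - q = P - Q ->
  / 2 * ln (p ^ 2 + xi ^ 2) - / 2 * ln (q ^ 2 + xi ^ 2) <= ln P - ln Q.
Proof.
  intros HQ H1 H2.
  assert (Hx := pow2_ge_0 xi).
  assert (E : forall y, 0 < y -> ln y = / 2 * ln (y ^ 2)).
  { intros y Hy. replace (y ^ 2) with (y * y) by ring. rewrite ln_mult by assumption. field. }
  rewrite (E P), (E Q) by lra.
  assert (0 < p ^ 2) by (apply pow_lt; lra). assert (0 < q ^ 2) by (apply pow_lt; lra).
  assert (0 < P ^ 2) by (apply pow_lt; lra). assert (0 < Q ^ 2) by (apply pow_lt; lra).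
  (* The parts with and without [xi] compare separately, by [Q <= P] and by [p Q <= q P]; the latter
     holds since [p - q = P - Q] and [Q <= q]. *)
  assert (L : ln ((p ^ 2 + xi ^ 2) * Q ^ 2) <= ln ((q ^ 2 + xi ^ 2) * P ^ 2)).
  { apply ln_le; [apply Rmult_lt_0_compat; lra|].
    rewrite !Rmult_plus_distr_r. apply Rplus_le_compat.
    - rewrite <- !Rpow_mult_distr. apply pow_incr. split; [apply Rmult_le_pos; lra | nra].
    - apply Rmult_le_compat_l; [assumption|]. apply pow_incr. lra. }
  rewrite !ln_mult in L by lra. lra.
Qed.

(* Termwise the worst case is [alpha = 1/2], where the product is Wallis'. *)
Lemma log_mod_T_B_le_wallis (alpha tau xi : R) (n : nat) :
  0 < alpha < 1 / 2 -> alpha <= tau ->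
  sum_f_R0 (fun k => ln (alpha + INR k) + ln (1 - alpha + INR k)) n
    - lnfact n - lnfact (S n) + log_beta alpha tau xi n
  <= sum_f_R0 (fun k => ln (1 / 2 + INR k) + ln (1 - 1 / 2 + INR k)) n
    - lnfact n - lnfact (S n) + ln 2 + ln (1 + alpha * / INR (S n)).
Proof.
  intros Ha Ht. unfold log_beta.
  induction n as [|n IH].
  - cbn [sum_f_R0]. rewrite lnfact_0, lnfact_1. change (INR 0) with 0. change (INR 1) with 1.
    (* Under [alpha <= tau] the extremal values are [tau = alpha], [xi = 0]; their denominators
       [1 - alpha + k] cancel against the sine product. *)
    assert (L := ln_modulus_quotient_le (tau + 1) (tau - 2 * alpha + 1)
                   (1 + alpha) (1 - alpha) xi ltac:(lra) ltac:(lra) ltac:(lra)).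
    rewrite !Rplus_0_r, Rinv_1, Rmult_1_r.
    rewrite (ln_mult 2 alpha) by lra.
    replace (1 - 1 / 2) with (/ 2) by field. replace (1 / 2) with (/ 2) by field.
    rewrite ln_Rinv by lra. lra.
  - rewrite !tech5, !(lnfact_S (S n)), !(lnfact_S n) in *.
    assert (HN : 1 <= INR (S n)) by (apply (le_INR 1); lia).
    assert (HN' : INR (S (S n)) = INR (S n) + 1) by apply S_INR.
    set (N := INR (S n)) in *. set (N' := INR (S (S n))) in *.
    assert (L := ln_modulus_quotient_le (tau + 1 + N) (tau - 2 * alpha + 1 + N)
                   (N' + alpha) (1 - alpha + N) xi ltac:(lra) ltac:(lra) ltac:(lra)).
    assert (E : forall M, 1 <= M -> ln (1 + alpha * / M) = ln (M + alpha) - ln M).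
    { intros M HM. rewrite <- ln_div by lra. f_equal. field. lra. }
    rewrite (E N) in IH by lra. rewrite (E N') by lra.
    (* This is what the induction step becomes after cancellation, with equality at
       [alpha = 1 / 2]. *)
    assert (W : ln ((N + alpha) * (N + alpha) * N') <= ln ((1 / 2 + N) * (1 / 2 + N) * (2 * alpha + N))).
    { apply ln_le; [repeat apply Rmult_lt_0_compat; lra|]. rewrite HN'.
      assert (alpha * alpha <= / 4) by nra. assert (alpha * alpha <= / 2 * alpha) by nra.
      nra. }
    rewrite (ln_mult (_ * _) N'), (ln_mult (_ * _) (2 * alpha + N)), !ln_mult in W
      by (try apply Rmult_lt_0_compat; lra).
    replace (1 - 1 / 2 + N) with (1 / 2 + N) by lra.
    replace (alpha + N) with (N + alpha) by ring.
    lra.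
Qed.

(** In the limit Wallis' product is the sine product at [1 / 2], so the bound is
    [2 sin (PI / 2) / PI]. *)
Lemma Cmod_T_B_le (alpha tau xi : R) :
  0 < alpha < 1 / 2 -> 0 < tau < 1 -> alpha <= tau ->
  Cmod (T_B alpha tau xi) <= 2 / PI.
Proof.
  intros Ha Ht Hat.
  assert (HPI := PI_RGT_0).
  destruct (T_B_polar alpha tau xi Ha Ht) as (l & t & Hl & _ & ->).
  assert (Hp := T_B_modulus_pos alpha l Ha).
  rewrite Cmod_polar by lra.
  assert (S0 : 0 < sin (PI * alpha) / PI).
  { apply Rdiv_lt_0_compat; [apply sin_gt_0; nra | assumption]. }
  assert (L : Rbar_le (ln (sin (PI * alpha) / PI) + l)
                      (ln (sin (PI * (1 / 2)) / PI) + ln 2 + 0)).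
  { eapply is_lim_seq_le.
    - intros n. apply (log_mod_T_B_le_wallis alpha tau xi n Ha Hat).
    - apply is_lim_seq_plus'; [apply ln_sine_lim; lra | exact Hl].
    - apply is_lim_seq_plus'; [apply is_lim_seq_plus'|].
      + apply ln_sine_lim; lra.
      + apply is_lim_seq_const.
      + apply is_lim_seq_ln_one_plus_div. }
  simpl in L.
  replace (PI * (1 / 2)) with (PI / 2) in L by field. rewrite sin_PI2 in L.
  assert (0 < 1 / PI) by (apply Rdiv_lt_0_compat; lra).
  rewrite <- (exp_ln (sin (PI * alpha) / PI)), <- exp_plus by assumption.
  rewrite <- (exp_ln (2 / PI)) by (apply Rdiv_lt_0_compat; lra).
  replace (2 / PI) with (1 / PI * 2) by (field; lra).
  rewrite (ln_mult (1 / PI)) by lra.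
  destruct L as [L | L]; [left; apply exp_increasing | right; f_equal]; lra.
Qed.

(** Two terms of the alternating series for [PI / 4 = 2 atan (1/3) + atan (1/7)]. *)
Lemma PI_gt_313 : 3.13 < PI.
Proof.
  assert (H := proj1 (PI_2_3_7_ineq 0)).
  unfold tg_alt, PI_2_3_7_tg, Ratan_seq in H. simpl in H. lra.
Qed.

Lemma tanh_PI_mul_gt (xi : R) :
  1 / 4 <= xi -> 2 / PI * cosh (PI * xi) < sinh (PI * xi).
Proof.
  intros Hxi. assert (HPI := PI_gt_313).
  set (y := PI * xi).
  (* The claim amounts to [exp (2 y) > (PI + 2) / (PI - 2)], which is below [4.54] for [PI > 3.13].
     Here [1.565 = 3.13 / 2], and the Taylor polynomial of degree four exceeds [4.6] there. *)
  assert (Hy : 1.565 <= 2 * y) by (unfold y; nra).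
  assert (T := exp_ge_taylor (2 * y) 4 ltac:(lra)). simpl in T.
  assert (E : 4.6 < exp (2 * y)) by nra.
  assert (Hm := exp_pos (- y)).
  assert (E2 : exp y = exp (2 * y) * exp (- y)).
  { rewrite <- exp_plus. f_equal. ring. }
  unfold cosh, sinh. rewrite E2.
  apply Rmult_lt_reg_l with PI; [lra|].
  replace (PI * (2 / PI * ((exp (2 * y) * exp (- y) + exp (- y)) / 2)))
    with ((exp (2 * y) + 1) * exp (- y)) by (field; lra).
  replace (PI * ((exp (2 * y) * exp (- y) - exp (- y)) / 2))
    with (PI * (exp (2 * y) - 1) / 2 * exp (- y)) by field.
  apply Rmult_lt_compat_r; [assumption|]. nra.
Qed.

(** [|sin (w + i PI xi)|^2 = sin w ^ 2 + sinh (PI xi) ^ 2] lies between the squares of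
    [sinh (PI xi)] and [cosh (PI xi)], whence the quotient is at least [tanh (PI xi)]. *)
Lemma Cmod_T_s_gt (alpha tau xi : R) :
  1 / 4 <= xi -> 2 / PI < Cmod (T_s alpha tau xi).
Proof.
  intros Hxi. assert (HPI := PI_RGT_0).
  assert (Hs : 0 < sinh (PI * xi)) by (apply sinh_pos; nra).
  assert (Hc := cosh_ge_1 (PI * xi)).
  assert (CS := cosh2_minus_sinh2 (PI * xi)).
  assert (B : forall w, sinh (PI * xi)
     <= Cmod (sin w * cosh (PI * xi), cos w * sinh (PI * xi)) <= cosh (PI * xi)).
  { intros w. unfold Cmod; cbn [fst snd].
    replace ((sin w * cosh (PI * xi)) ^ 2 + (cos w * sinh (PI * xi)) ^ 2)
      with (sin w ^ 2 + sinh (PI * xi) ^ 2).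
    - assert (S2 := sin2_cos2 w). unfold Rsqr in S2.
      split.
      + rewrite <- (sqrt_pow2 (sinh (PI * xi))) at 1 by lra.
        apply sqrt_le_1_alt. generalize (pow2_ge_0 (sin w)). lra.
      + rewrite <- (sqrt_pow2 (cosh (PI * xi))) by lra.
        apply sqrt_le_1_alt. generalize (pow2_ge_0 (cos w)). nra.
    - assert (S2 := sin2_cos2 w). unfold Rsqr in S2.
      replace ((sin w * cosh (PI * xi)) ^ 2) with (sin w ^ 2 * (1 + sinh (PI * xi) ^ 2))
        by (rewrite Rpow_mult_distr; f_equal; lra).
      transitivity (sin w ^ 2 + sinh (PI * xi) ^ 2 * (sin w * sin w + cos w * cos w));
        [rewrite S2|]; ring. }
  rewrite T_s_quotient.
  assert (B1 := B (PI * (tau - alpha))). assert (B2 := B (PI * (tau - 2 * alpha))).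
  rewrite Cmod_div.
  2:{ intros Z. rewrite Z, Cmod_0 in B2. lra. }
  assert (T := tanh_PI_mul_gt xi Hxi).
  apply (proj1 (Rlt_div_r _ _ _ (Rlt_le_trans _ _ _ Hs (proj1 B2)))).
  assert (0 < 2 / PI) by (apply Rdiv_lt_0_compat; lra).
  apply Rle_lt_trans with (2 / PI * cosh (PI * xi)); [apply Rmult_le_compat_l; lra | lra].
Qed.

(* At [tau = 2 * alpha] both sides are [0], division by zero being [0]. *)
Lemma T_s_real (alpha tau : R) :
  T_s alpha tau 0 = RtoC (sin (PI * (tau - alpha)) / sin (PI * (tau - 2 * alpha))).
Proof.
  rewrite T_s_quotient, Rmult_0_r, cosh_0, sinh_0, !Rmult_1_r, !Rmult_0_r.
  generalize (sin (PI * (tau - alpha))) (sin (PI * (tau - 2 * alpha))). intros a b.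
  unfold Cdiv, Cinv, Cmult, RtoC; cbn [fst snd].
  destruct (Req_dec b 0) as [-> | Hb].
  - unfold Rdiv. rewrite Rinv_0. f_equal; ring.
  - f_equal; field; lra.
Qed.

Lemma T_B_real (alpha tau : R) :
  0 < alpha < 1 / 2 -> 0 < tau < 1 ->
  exists l : R, is_lim_seq (log_beta alpha tau 0) l /\
  T_B alpha tau 0 = RtoC (sin (PI * alpha) / PI * exp l).
Proof.
  intros Ha Ht.
  destruct (T_B_polar alpha tau 0 Ha Ht) as (l & t & Hl & Hlt & ->).
  exists l. split; [assumption|]. rewrite polar_real. f_equal.
  assert (E : is_lim_seq (arg_beta alpha tau 0) 0).
  { apply is_lim_seq_ext with (fun _ => 0); [|apply is_lim_seq_const].
    intros n. unfold arg_beta. rewrite (sum_eq _ (fun _ => 0)).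
    - rewrite sum_cte. ring.
    - intros k _. unfold Rdiv. rewrite !Rmult_0_l. ring. }
  apply is_lim_seq_unique in E. apply is_lim_seq_unique in Hlt. congruence.
Qed.

(** * Comparison on the real axis, [xi = 0] *)

Lemma log_ratio_term_neg (alpha tau k : R) :
  0 < alpha < 1 / 2 -> 0 < tau < alpha -> 0 <= k ->
  ln (alpha - tau + k) + ln (1 - (alpha - tau) + k) + ln (2 * alpha + k) + ln (k + 1)
  < ln (2 * alpha - tau + k) + ln (tau + 1 + k) + ln (alpha + k) + ln (1 - alpha + k).
Proof.
  intros Ha Ht Hk.
  rewrite <- !ln_mult by (repeat apply Rmult_lt_0_compat; lra).
  apply ln_increasing; [repeat apply Rmult_lt_0_compat; lra|].
  (* Paired this way, the two products are [(D - alpha tau) (D' + alpha tau)] and [D D']: the first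
     has the same sum of factors, moved further apart since [D < D']. *)
  set (D := (2 * alpha - tau + k) * (alpha + k)).
  set (D' := (tau + 1 + k) * (1 - alpha + k)).
  assert (HD : D < D') by (unfold D, D'; nra).
  assert (Hat : 0 < alpha * tau) by nra.
  replace ((alpha - tau + k) * (1 - (alpha - tau) + k) * (2 * alpha + k) * (k + 1))
    with ((D - alpha * tau) * (D' + alpha * tau)) by (unfold D, D'; ring).
  replace ((2 * alpha - tau + k) * (tau + 1 + k) * (alpha + k) * (1 - alpha + k))
    with (D * D') by (unfold D, D'; ring).
  nra.
Qed.

Lemma lnfact_sum (n : nat) : lnfact (S n) = sum_f_R0 (fun k => ln (INR k + 1)) n.
Proof.
  induction n as [|n IH].
  - unfold lnfact; simpl. f_equal. ring.
  - rewrite tech5, <- IH, lnfact_S. rewrite (S_INR (S n)). reflexivity.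
Qed.

(** Applying [ln_sine_lim] to all three sines makes the logarithm of [T_s / T_B] the sum of the
    [b k]. All are negative, so the sum is at most [b 0 < 0]. *)
Lemma real_case_small_tau (alpha tau l : R) :
  0 < alpha < 1 / 2 -> 0 < tau < alpha -> is_lim_seq (log_beta alpha tau 0) l ->
  sin (PI * (tau - alpha)) / sin (PI * (tau - 2 * alpha)) < sin (PI * alpha) / PI * exp l.
Proof.
  intros Ha Ht Hl. assert (HPI := PI_RGT_0).
  set (b := fun k => ln (alpha - tau + INR k) + ln (1 - (alpha - tau) + INR k)
     + ln (2 * alpha + INR k) + ln (INR k + 1)
     - (ln (2 * alpha - tau + INR k) + ln (tau + 1 + INR k) + ln (alpha + INR k)
        + ln (1 - alpha + INR k))).
  assert (Hb : forall k, b k < 0).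
  { intros k. unfold b.
    generalize (log_ratio_term_neg alpha tau (INR k) Ha Ht (pos_INR k)). lra. }
  assert (P : forall x, 0 < x < 1 -> 0 < sin (PI * x) / PI).
  { intros x Hx. apply Rdiv_lt_0_compat; [apply sin_gt_0; nra | assumption]. }
  assert (L : Rbar_le (ln (sin (PI * (alpha - tau)) / PI)
     - ln (sin (PI * (2 * alpha - tau)) / PI) - ln (sin (PI * alpha) / PI) - l) (b 0%nat)).
  { apply is_lim_seq_le with (sum_f_R0 b) (fun _ => b 0%nat); [| |apply is_lim_seq_const].
    - intros n. induction n as [|n IH]; [apply Rle_refl|].
      rewrite tech5. generalize (Hb (S n)). lra.
    - eapply is_lim_seq_ext; [|repeat apply is_lim_seq_minus';
        [apply ln_sine_lim | apply ln_sine_lim | apply ln_sine_lim | exact Hl]; lra].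
      intros n. cbv beta. unfold log_beta.
      rewrite (sum_eq (fun k => / 2 * ln ((tau + 1 + INR k) ^ 2 + 0 ^ 2)
                 - / 2 * ln ((tau - 2 * alpha + 1 + INR k) ^ 2 + 0 ^ 2)
                 - ln (2 * alpha + INR k))
                (fun k => ln (tau + 1 + INR k) - ln (1 - (2 * alpha - tau) + INR k)
                          - ln (2 * alpha + INR k))).
      2:{ intros k _. assert (Hk := pos_INR k). rewrite !half_ln_sqr by lra.
          do 3 f_equal. ring. }
      rewrite lnfact_sum.
      induction n as [|n IH].
      + unfold b; simpl. ring.
      + rewrite !tech5, !lnfact_S, <- IH. unfold b. ring. }
  simpl in L. assert (B0 := Hb 0%nat).
  replace (PI * (tau - alpha)) with (- (PI * (alpha - tau))) by ring.
  replace (PI * (tau - 2 * alpha)) with (- (PI * (2 * alpha - tau))) by ring.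
  rewrite !sin_neg.
  assert (P1 := P (alpha - tau) ltac:(lra)). assert (P2 := P (2 * alpha - tau) ltac:(lra)).
  assert (P3 := P alpha ltac:(lra)).
  assert (S2 : 0 < sin (PI * (2 * alpha - tau))) by (apply sin_gt_0; nra).
  replace (- sin (PI * (alpha - tau)) / - sin (PI * (2 * alpha - tau)))
    with ((sin (PI * (alpha - tau)) / PI) / (sin (PI * (2 * alpha - tau)) / PI))
    by (field; lra).
  apply ln_lt_inv.
  - now apply Rdiv_lt_0_compat.
  - apply Rmult_lt_0_compat; [assumption | apply exp_pos].
  - rewrite ln_div, ln_mult, ln_exp by (try apply exp_pos; assumption). lra.
Qed.

(** The extremal case is [tau = 2 alpha], where the product telescopes; in the limit this bounds the
    Beta value by [B(1, 2 alpha) = 1 / (2 alpha)]. *)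
Lemma log_beta_le (alpha tau : R) (n : nat) :
  0 < alpha < 1 / 2 -> 2 * alpha <= tau ->
  log_beta alpha tau 0 n <= - ln (2 * alpha) + ln (1 + 2 * alpha * / INR (S n)).
Proof.
  intros Ha Ht. unfold log_beta. induction n as [|n IH].
  - cbn [sum_f_R0]. rewrite lnfact_0. change (INR 0) with 0. change (INR 1) with 1.
    assert (L := ln_modulus_quotient_le (tau + 1) (tau - 2 * alpha + 1) (1 + 2 * alpha) 1 0
                   ltac:(lra) ltac:(lra) ltac:(lra)).
    rewrite ln_1 in L. rewrite !Rplus_0_r, Rinv_1, Rmult_1_r. lra.
  - rewrite tech5, lnfact_S.
    assert (HN : 1 <= INR (S n)) by (apply (le_INR 1); lia).
    assert (HN' : INR (S (S n)) = INR (S n) + 1) by apply S_INR.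
    set (N := INR (S n)) in *. set (N' := INR (S (S n))) in *.
    assert (L := ln_modulus_quotient_le (tau + 1 + N) (tau - 2 * alpha + 1 + N)
                   (2 * alpha + N') N' 0 ltac:(lra) ltac:(lra) ltac:(lra)).
    assert (E : forall M, 1 <= M -> ln (1 + 2 * alpha * / M) = ln (2 * alpha + M) - ln M).
    { intros M HM. rewrite <- ln_div by lra. f_equal. field. lra. }
    rewrite (E N) in IH by lra. rewrite (E N') by lra. lra.
Qed.

(** The value [1 / 2] separates the sides: on the left [sin (PI alpha) < PI alpha] meets the bound
    [1 / (2 alpha)], and on the right the claim is that the denominator is less than twice the
    numerator. *)
Lemma real_case_large_tau (alpha tau l : R) :
  0 < alpha < 1 / 2 -> 2 * alpha < tau < 1 -> is_lim_seq (log_beta alpha tau 0) l ->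
  sin (PI * alpha) / PI * exp l < sin (PI * (tau - alpha)) / sin (PI * (tau - 2 * alpha)).
Proof.
  intros Ha Ht Hl. assert (HPI := PI_RGT_0).
  assert (L : Rbar_le l (- ln (2 * alpha) + 0)).
  { eapply is_lim_seq_le; [|exact Hl|].
    - intros n. apply (log_beta_le alpha tau n); lra.
    - apply is_lim_seq_plus'; [apply is_lim_seq_const | apply is_lim_seq_ln_one_plus_div]. }
  simpl in L.
  assert (EL : exp l <= / (2 * alpha)).
  { rewrite <- (exp_ln (2 * alpha)), <- exp_Ropp by lra.
    destruct L as [L | L]; [left; apply exp_increasing | right; f_equal]; lra. }
  apply Rlt_trans with (1 / 2).
  - assert (Sx := sin_lt_x (PI * alpha) ltac:(nra)).
    assert (S0 : 0 < sin (PI * alpha) / PI)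
      by (apply Rdiv_lt_0_compat; [apply sin_gt_0; nra | assumption]).
    apply Rle_lt_trans with (sin (PI * alpha) / PI * / (2 * alpha)).
    + apply Rmult_le_compat_l; lra.
    + replace (1 / 2) with (PI * alpha / PI * / (2 * alpha)) by (field; lra).
      apply Rmult_lt_compat_r; [apply Rinv_0_lt_compat; lra|].
      unfold Rdiv. apply Rmult_lt_compat_r; [apply Rinv_0_lt_compat; lra | assumption].
  - assert (S2 : 0 < sin (PI * (tau - 2 * alpha))) by (apply sin_gt_0; nra).
    apply (proj1 (Rlt_div_r _ _ _ S2)).
    (* Now [0 < p < q < 2 p] and [q < PI], and [sin q < 2 sin p] is needed. For [p <= PI / 2],
       [sin q <= 2 sin (q / 2) < 2 sin p]; beyond [PI / 2] the sine decreases. *)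
    set (p := PI - PI * (tau - alpha)). set (q := PI - PI * (tau - 2 * alpha)).
    replace (sin (PI * (tau - alpha))) with (sin p)
      by (unfold p; rewrite sin_PI_x; reflexivity).
    replace (sin (PI * (tau - 2 * alpha))) with (sin q) in *
      by (unfold q; rewrite sin_PI_x; reflexivity).
    assert (Hp : 0 < p) by (unfold p; nra).
    assert (Hpq : p < q < 2 * p) by (unfold p, q; nra).
    assert (Hq : q < PI) by (unfold q; nra).
    destruct (Rle_dec p (PI / 2)) as [H | H].
    + assert (S1 : sin (q / 2) < sin p) by (apply sin_increasing_1; lra).
      assert (0 < sin (q / 2)) by (apply sin_gt_0; lra).
      assert (E : sin q = 2 * sin (q / 2) * cos (q / 2)).
      { replace q with (2 * (q / 2)) at 1 by field. apply sin_2a. }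
      generalize (COS_bound (q / 2)). nra.
    + assert (S1 : sin q < sin p) by (apply sin_decreasing_1; lra). lra.
Qed.

Lemma real_case (alpha tau : R) :
  0 < alpha < 1 / 2 -> 0 < tau < 1 -> T_s alpha tau 0 <> T_B alpha tau 0.
Proof.
  intros Ha Ht. assert (HPI := PI_RGT_0).
  destruct (T_B_real alpha tau Ha Ht) as (l & Hl & ->).
  assert (Hp := T_B_modulus_pos alpha l Ha).
  rewrite T_s_real. intros E. apply RtoC_inj in E.
  destruct (Rlt_le_dec tau alpha) as [H | H].
  { generalize (real_case_small_tau alpha tau l Ha ltac:(lra) Hl). lra. }
  destruct (Rlt_le_dec (2 * alpha) tau) as [H' | H'].
  { generalize (real_case_large_tau alpha tau l Ha ltac:(lra) Hl). lra. }
  assert (S1 : 0 <= sin (PI * (tau - alpha))) by (apply sin_ge_0; nra).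
  assert (S2 : 0 <= sin (PI * (2 * alpha - tau))) by (apply sin_ge_0; nra).
  replace (PI * (tau - 2 * alpha)) with (- (PI * (2 * alpha - tau))) in E by ring.
  rewrite sin_neg in E. unfold Rdiv at 1 in E.
  destruct S2 as [S2 | S2].
  - rewrite Rinv_opp in E. generalize (Rinv_0_lt_compat _ S2). nra.
  (* The sine vanishes at [tau = 2 alpha], where the quotient is [0] by convention and still differs
     from the positive [T_B]. *)
  - rewrite <- S2, Ropp_0, Rinv_0 in E. lra.
Qed.

(** * Conjugation symmetry and conclusion *)

Lemma T_s_opp (alpha tau xi : R) : T_s alpha tau (- xi) = Cconj (T_s alpha tau xi).
Proof.
  rewrite !T_s_quotient.
  replace (PI * - xi) with (- (PI * xi)) by ring. rewrite sinh_opp, cosh_opp.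
  unfold Cconj, Cdiv, Cinv, Cmult; cbn [fst snd].
  rewrite !Ropp_mult_distr_r_reverse, <- !Rsqr_pow2, <- !Rsqr_neg.
  unfold Rdiv. f_equal; ring.
Qed.

(** [log_beta] depends on [xi] only through [xi^2] and [arg_beta] is odd in [xi]; uniqueness of
    limits transfers this to modulus and argument. *)
Lemma T_B_opp (alpha tau xi : R) :
  0 < alpha < 1 / 2 -> 0 < tau < 1 ->
  T_B alpha tau (- xi) = Cconj (T_B alpha tau xi).
Proof.
  intros Ha Ht.
  destruct (T_B_polar alpha tau xi Ha Ht) as (l & t & Hl & Hlt & ->).
  destruct (T_B_polar alpha tau (- xi) Ha Ht) as (l' & t' & Hl' & Hlt' & ->).
  assert (El : l' = l).
  { apply is_lim_seq_unique in Hl, Hl'.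
    rewrite (Lim_seq_ext _ (log_beta alpha tau xi)) in Hl'; [congruence|].
    intros n. unfold log_beta. now replace ((- xi) ^ 2) with (xi ^ 2) by ring. }
  assert (Et : t' = - t).
  { apply is_lim_seq_opp in Hlt. simpl in Hlt.
    apply is_lim_seq_unique in Hlt, Hlt'.
    rewrite (Lim_seq_ext _ (fun n => - arg_beta alpha tau xi n)) in Hlt'; [congruence|].
    intros n. unfold arg_beta. clear.
    induction n as [|n IH]; rewrite ?tech5, ?IH; simpl sum_f_R0;
      rewrite !Rdiv_opp_l, !atan_opp; ring. }
  rewrite El, Et. unfold polar, Cconj; cbn [fst snd]. rewrite cos_neg, sin_neg. f_equal. ring.
Qed.

Theorem theorem9p3 (alpha tau xi : R) :
  0 < alpha < 1 / 2 -> 0 < tau < 1 ->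
  (xi = 0 -> T_s alpha tau xi <> T_B alpha tau xi) /\
  (1 / 4 <= xi -> alpha <= tau ->
     Cmod (T_s alpha tau xi) > Cmod (T_B alpha tau xi)) /\
  (0 < xi < 1 / 4 -> alpha <= tau ->
     carg (T_s alpha tau xi) < carg (T_B alpha tau xi)) /\
  (0 < xi -> tau < alpha ->
     carg (T_s alpha tau xi) <> carg (T_B alpha tau xi)) /\
  T_s alpha tau xi <> T_B alpha tau xi.
Proof.
  intros Ha Ht.
  assert (P : forall x, 0 < x -> T_s alpha tau x <> T_B alpha tau x).
  { intros x Hx E. generalize (T_s_T_B_args alpha tau x Ha Ht Hx). rewrite E. lra. }
  repeat split.
  - intros ->. now apply real_case.
  - intros Hx Hat.
    apply Rle_lt_trans with (2 / PI); [now apply Cmod_T_B_le | now apply Cmod_T_s_gt].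
  - intros Hx _. now apply T_s_T_B_args.
  - intros Hx _. now apply Rlt_not_eq, T_s_T_B_args.
  - destruct (Rtotal_order xi 0) as [H | [-> | H]].
    + intros E. apply (P (- xi)); [lra|]. now rewrite T_s_opp, T_B_opp, E.
    + now apply real_case.
    + now apply P.
Qed.
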